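(* Let $\Omega\in\mathcal R$, let $(A,dk)\in\mathcal D$ be the pair associated with $\Omega$, and let $0\le\alpha\le\pi$. Then $\Omega$ has a slit at angle $e^{i\alpha}$ if and only if $k=\alpha/\pi$ is a gap label of $E=\mathrm{top\,supp}\,dk$.
   Context: Notation: $\mathbb C^+$ is the open upper half plane, $D=\{|z|<1\}$, $D^+=D\cap\mathbb C^+$, $S^1=\partial D$. $\mathcal D$ is the set of pairs $(A,dk)$ with $A>0$ and $dk$ a Borel probability measure on $[-2,2]$ such that $-\ln A+\int_{[-2,2]}\ln|t-z|\,dk(t)\ge 0$ for all $z\in\mathbb C$. $\mathcal R$ is the set of regions $\Omega=\Omega_h:=\{re^{i\alpha}:0\le r<1-h(e^{i\alpha})\}\subset D$, where $h:S^1\to[0,1)$ is upper semicontinuous with $h(e^{-i\alpha})=h(e^{i\alpha})$; $h$ is determined by $\Omega$ and called its slit height function. The region associated with $(A,dk)\in\mathcal D$ is $\Omega=F(D)\in\mathcal R$, where $F$ is the holomorphic extension to $D$ by reflection $F(\overline\zeta)=\overline{F(\zeta)}$ of $F(\zeta)=e^{w(-\zeta-1/\zeta)}$, $\zeta\in D^+$, with $w(z)=\ln A-\int_{[-2,2]}\ln(t-z)\,dk(t)$ for $z\in\mathbb C^+$ and $\mathrm{Im}\,\ln\zeta\in(-\pi,0)$ for $\zeta$ in the open lower half plane. Every $\Omega\in\mathcal R$ is associated with exactly one $(A,dk)\in\mathcal D$. Gap labels: $E=\mathrm{top\,supp}\,dk$ is the smallest closed set whose complement has $dk$-measure zero. The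 set $(-2,2)\setminus E$ is a disjoint union of open intervals $I_j$, called gaps. On each gap the function $k(t)=\int_{[-2,t]}dk(s)$ has a constant value $k_j\in[0,1]$, called the gap label of $I_j$. The gap labels of $E$ are the numbers $k_j$ obtained in this way. Slits: $\Omega$ has a slit at angle $e^{i\alpha}$ if $h(e^{i\alpha})>\limsup_{t\to0+}h(e^{i(\alpha+\sigma t)})$ for at least one of $\sigma=1$ or $\sigma=-1$. *)

(* Defs.v *)
(* MathComp-Analysis, over an arbitrary [R : realType]; the complex plane is
   [R[i]] (mathcomp-real-closed). *)
From HB Require Import structures.
From mathcomp Require Import all_boot all_order all_algebra.
From mathcomp Require Import all_classical all_reals all_analysis.
From mathcomp Require Import complex.

Set Implicit Arguments.
Unset Strict Implicit.
Unset Printing Implicit Defensive.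

Import Order.TTheory GRing.Theory Num.Theory numFieldNormedType.Exports.

Local Open Scope classical_set_scope.
Local Open Scope complex_scope.
Local Open Scope ring_scope.

Section Complex.
Context {R : realType}.
Implicit Types (z : R[i]) (F : R[i] -> R[i]).

Definition upper_half_plane : set R[i] := [set z | 0 < complex.Im z].

Definition unit_disc : set R[i] := [set z | `|z| < 1].

Definition upper_half_disc : set R[i] := unit_disc `&` upper_half_plane.

Definition unit_circle : set R[i] := [set z | `|z| = 1].

Definition expi (alpha : R) : R[i] := cos alpha +i* sin alpha.

Definition cexp z : R[i] := (expR (complex.Re z))%:C * expi (complex.Im z).

(* The branch of the logarithm on the open lower half plane with imaginary part
   in ]-pi, 0[. It is meaningful only for [complex.Im z < 0]. *)
Definition cln_lower z : R[i] :=
  ln (Normc.normc z)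
    +i* (- acos (complex.Re z / Normc.normc z)).

(* [R[i]^o] is the normed space [R[i]] over the scalar field [R[i]], so that
   this is complex differentiability. *)
Definition holomorphic_on (U : set R[i]) F :=
  forall z, U z -> derivable (F : R[i]^o -> R[i]^o) z 1.

End Complex.

Section Pairs.
Context {R : realType}.
Implicit Types (A : R) (dk : probability (measurableTypeR R) R).

Definition itv22 : set R := `[-2, 2]%classic.

(* [lne] takes the value [-oo] at 0, whereas [ln 0 = 0]; the integral may be
   [-oo] when [z] is real. *)
Definition pair_class A dk :=
  [/\ 0 < A,
      dk itv22 = 1%E &
      forall z : R[i],
        (0 <= - (ln A)%:E
              + \int[dk]_(t in itv22)
                  lne (Normc.normc (t%:C - z))%:E)%E].

Definition wfun A dk (z : R[i]) : R[i] :=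
  (ln A)%:C
  - ((\int[dk]_(t in itv22) complex.Re (cln_lower (t%:C - z)))
     +i* (\int[dk]_(t in itv22) complex.Im (cln_lower (t%:C - z)))).

(* [F] is determined by these conditions on the unit disc: by the second on the
   upper half disc, by the third on the lower one, and by continuity on
   ]-1, 1[. *)
Definition conformal_extension A dk (F : R[i] -> R[i]) :=
  [/\ holomorphic_on unit_disc F,
      forall z, upper_half_disc z -> F z = cexp (wfun A dk (- z - z^-1)) &
      forall z, unit_disc z -> F (conjc z) = conjc (F z)].

Definition associated (Omega : set R[i]) A dk :=
  exists2 F, conformal_extension A dk F & Omega = F @` unit_disc.

Definition top_supp dk : set R :=
  \bigcap_(C in [set C : set R | closed C /\ dk (~` C) = 0%E]) C.

Definition distribution_function dk (t : R) : R := fine (dk `[-2, t]%classic).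

Definition is_gap (E I : set R) :=
  let G : set R := `]-2, 2[%classic `\` E in
  exists2 x, G x & I = connected_component G x.

Definition gap_label dk (kappa : R) :=
  exists2 I, is_gap (top_supp dk) I &
    forall t, I t -> distribution_function dk t = kappa.

End Pairs.

Section Regions.
Context {R : realType}.
Implicit Types h : R[i] -> R.

Definition upper_semicontinuous_on (S : set R[i]) h :=
  forall z, S z -> forall a, h z < a ->
    \forall u \near within S (nbhs (z : R[i]^o)), h u < a.

(* Only the values of [h] on the unit circle matter. *)
Definition slit_height_function h :=
  [/\ forall z, unit_circle z -> 0 <= h z < 1,
      upper_semicontinuous_on unit_circle h &
      forall alpha, h (expi (- alpha)) = h (expi alpha)].

Definition region h : set R[i] :=
  [set z | exists r alpha : R,
    0 <= r < 1 - h (expi alpha) /\ z = r%:C * expi alpha].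

Definition has_slit h (alpha : R) :=
  exists2 sigma : R, sigma = 1 \/ sigma = -1 &
    (limf_esup (fun t : R => (h (expi (alpha + sigma * t)))%:E) 0^'+
       < (h (expi alpha))%:E)%E.

End Regions.

(* Main.v *)
Require Import Defs.
From HB Require Import structures.
From mathcomp Require Import all_boot all_order all_algebra.
From mathcomp Require Import all_classical all_reals all_analysis.
From mathcomp Require Import complex.
From mathcomp Require Import measurable_realfun.
From mathcomp Require Import ring lra.

Set Implicit Arguments.
Unset Strict Implicit.
Unset Printing Implicit Defensive.

Import Order.TTheory GRing.Theory Num.Theory numFieldNormedType.Exports.

Local Open Scope classical_set_scope.
Local Open Scope complex_scope.
Local Open Scope ring_scope.

(** Write [z = x + i y] and [w = u + i v] for the function on the upper half plane
    attached to [(A, dk)]. Each [- ln (t - z)] has a derivative with positive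
    imaginary part, hence so does [w], and integrating [w'] along segments gives
    [(v1 - v2) (x1 - x2) >= (u1 - u2) (y1 - y2)] for any two points; this persists
    up to the real axis, where [v = pi k]. So [u] decreases with the height along
    a level set [v = alpha], [1 - h (e^(i alpha))] is the supremum of [e^u] on it,
    and this is at most [e^(u x)] for every real [x] with [pi (k x) = alpha], with
    equality if there is only one such [x].
    On a gap [u] is strictly convex, so it takes two values [u x1 < u x2] there.
    The inequality makes the level sets [v = beta], with [beta] close to [alpha] on
    one side of it, pass near [x2]; there [e^u] exceeds [e^(u x1)] by a fixed
    amount, which is a slit.
    If [alpha / pi] is not a gap label, then the real point [x] with
    [pi (k x) = alpha] is unique. Averaging the logarithmic potential over the
    intervals [[x + l, x + 2 l]] produces points [x' -> x], on either side of [x],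
    with [limsup (u x') <= u x], so there is no slit. *)

(** * The logarithm of [t - z] *)

Section Pointwise.
Context {R : realType}.
Implicit Types (c d y r s t : R).

(* [ln (c - i y) = logmod c y - i * angle c y] for [0 < y]. On the real axis [angle]
   is the boundary value, except at [c = 0] where none exists; [logmod 0 0 = 0]. *)
Definition logmod c y : R := ln (c ^+ 2 + y ^+ 2) / 2.

Definition angle c y : R :=
  if y == 0 then (if c <= 0 then pi else 0) else pi / 2 - atan (c / `|y|).

Let scaleE (a b : R) : a *: b = a * b. Proof. by []. Qed.

Lemma is_derive_affine c d s : is_derive s 1 (fun r => c + r * d) d.
Proof.
have H := is_deriveD (is_derive_cst c s (1 : R)) (is_deriveZ d (is_derive_id s (1 :
  R))).
rewrite (_ : (fun r => _) = cst c + d *: id); last first.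
  by apply/funext => r; rewrite !fctE /GRing.scale/= mulrC.
by apply: (is_derive_eq H); rewrite add0r /GRing.scale/= mulr1.
Qed.

(** The right-hand side is the increment over [[0, 1]] of a function [phi] along the segment joining
    the two points. Its derivative is the imaginary part of [1 / (c - i y)], positive for [y > 0],
    times the squared length of the segment. *)
Lemma logmod_angle_mono c1 y1 c2 y2 : 0 < y1 -> 0 < y2 ->
  0 <= (angle c1 y1 - angle c2 y2) * (c2 - c1)
     + (logmod c1 y1 - logmod c2 y2) * (y1 - y2).
Proof.
move=> y10 y20.
pose c (s : R) := c2 + s * (c1 - c2).
pose y (s : R) := y2 + s * (y1 - y2).
pose phi := fun s : R => - atan (c s / y s) * (c2 - c1)
  + ln (c s ^+ 2 + y s ^+ 2) / 2 * (y1 - y2).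
pose dphi := fun s : R => y s / (c s ^+ 2 + y s ^+ 2) *
  ((c1 - c2) ^+ 2 + (y1 - y2) ^+ 2).
have ypos s : s \in `[0, 1] -> 0 < y s.
  rewrite in_itv/= => /andP[s0 s1]; rewrite /y.
  rewrite (_ : _ + _ = (1 - s) * y2 + s * y1); last by ring.
  move: s0; rewrite le_eqVlt => /predU1P[<-|s0];
    first by rewrite subr0 mul1r mul0r addr0.
  by rewrite ltr_wpDl ?mulr_gt0// mulr_ge0 ?subr_ge0// ltW.
have dpos s : s \in `[0, 1] -> is_derive s 1 phi (dphi s).
  move=> /ypos ys0.
  have N0 : 0 < c s ^+ 2 + y s ^+ 2.
    by rewrite ltr_wpDl ?sqr_ge0// exprn_gt0.
  have dc : is_derive s (1:R) c (c1 - c2) by exact: is_derive_affine.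
  have dy : is_derive s (1:R) y (y1 - y2) by exact: is_derive_affine.
  have dyV : is_derive s (1:R) (fun s => (y s)^-1) (- (y s) ^- 2 *: (y1 - y2)).
    by apply: is_deriveV; rewrite gt_eqF.
  have dcy := is_deriveM dc dyV.
  have datan := is_derive1_comp (is_derive1_atan _) dcy.
  have dN := is_deriveD (is_deriveM dc dc) (is_deriveM dy dy).
  have N0' : 0 < (c * c + y * y) s by rewrite !fctE -!expr2.
  have dln := is_derive1_comp (is_derive1_ln N0') dN.
  have H := is_deriveD (is_deriveN (is_deriveZ (c2 - c1) datan)) (is_deriveZ ((y1 -
    y2) / 2) dln).
  rewrite (_ : phi = - ((c2 - c1) \*: (atan \o (c * (fun s =>
    (y s)^-1)))) + ((y1 - y2) / 2) \*: (@ln R \o (c * c + y * y))); last first.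
    by apply/funext => r; rewrite /phi !fctE/= !scaleE !expr2; field.
  apply: (is_derive_eq H).
  rewrite /dphi !fctE/= !scaleE; field.
  by rewrite !gt_eqF//= addrC.
have M1 : forall s, s \in `]0, 1[ -> is_derive s 1 phi (dphi s).
  by move=> s /subset_itv_oo_cc s01; exact: dpos.
have M2 : {within `[0, 1], continuous phi}.
  apply: derivable_within_continuous => s s01.
  by have [] := dpos s s01.
have [s s01 E] := MVT ltr01 M1 M2.
have : 0 <= phi 1 - phi 0.
  rewrite E subr0 mulr1 /dphi.
  have := ypos s (subset_itv_oo_cc s01) => ys0.
  apply: mulr_ge0; last by apply: addr_ge0; exact: sqr_ge0.
  by apply: divr_ge0; [exact: ltW|apply: addr_ge0; exact: sqr_ge0].
rewrite /phi /c /y !mul0r !mul1r !addr0 !subrKC /angle !gt_eqF // !gtr0_norm //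
  /logmod.
by move=> H; apply: le_trans H _; lra.
Qed.

Lemma sqr_sum_gt0 c y : (c != 0) || (y != 0) -> 0 < c ^+ 2 + y ^+ 2.
Proof.
move=> /orP[h|h]; [apply: ltr_wpDr|apply: ltr_wpDl]; rewrite ?sqr_ge0//;
by rewrite lt_def sqrf_eq0 h sqr_ge0.
Qed.

Lemma logmod0E c : logmod c 0 = ln `|c|.
Proof.
rewrite /logmod expr0n/= addr0 -real_normK ?num_real//.
have [->|c0] := eqVneq c 0; first by rewrite normr0 expr0n/= ln0// mul0r.
by rewrite lnXn ?normr_gt0// mulr2n; lra.
Qed.

Lemma ler_logmod c y c' y' : (c != 0) || (y != 0) ->
  c ^+ 2 + y ^+ 2 <= c' ^+ 2 + y' ^+ 2 -> logmod c y <= logmod c' y'.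
Proof.
move=> /sqr_sum_gt0 h le; rewrite /logmod ler_pM2r// ler_ln// posrE//.
exact: lt_le_trans le.
Qed.

Lemma angle_ge0 c y : 0 <= angle c y.
Proof.
rewrite /angle; case: ifP => _; first by case: ifP => _ //; exact: pi_ge0.
by rewrite subr_ge0 ltW// atan_ltpi2.
Qed.

Lemma angle_le_pi c y : angle c y <= pi.
Proof.
rewrite /angle; case: ifP => _; first by case: ifP => _ //; exact: pi_ge0.
have := atan_gtNpi2 (c / `|y|); lra.
Qed.

Lemma angle_gt0 c y : y != 0 -> 0 < angle c y.
Proof. by move=> /negPf y0; rewrite /angle y0 subr_gt0 atan_ltpi2. Qed.

Lemma angle_lt_pi c y : y != 0 -> angle c y < pi.
Proof.
move=> /negPf y0; rewrite /angle y0.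
have := atan_gtNpi2 (c / `|y|); lra.
Qed.

Lemma angle_lt_pihalf c y : 0 < c -> angle c y < pi / 2.
Proof.
move=> c0; rewrite /angle leNgt c0/=; case: ifPn => [_|y0].
  by rewrite divr_gt0// pi_gt0.
by rewrite ltrBlDr ltrDl -[ltLHS]atan0 lt_atan// divr_gt0// normr_gt0.
Qed.

Lemma angle_gt_pihalf c y : c < 0 -> pi / 2 < angle c y.
Proof.
move=> c0; rewrite /angle (ltW c0)/=; case: ifPn => [_|y0].
  by rewrite ltr_pdivrMr// mulr_natr mulr2n ltrDl pi_gt0.
rewrite ltrBrDr gtrDl -[ltRHS]atan0 lt_atan// pmulr_llt0// invr_gt0.
by rewrite normr_gt0.
Qed.

Lemma atanV r : 0 < r -> atan r^-1 = pi / 2 - atan r.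
Proof.
move=> r0; have ar0 : 0 < atan r by rewrite -atan0 lt_atan.
have arp := atan_ltpi2 r; have pi0 := pi_gt0 R.
apply: tan_inj; rewrite ?in_itv/= ?atan_gtNpi2 ?atan_ltpi2//.
  by apply/andP; split; lra.
rewrite atanK /tan.
have -> : sin (pi / 2 - atan r) = cos (atan r).
  by rewrite -(cosN (atan r)) -sinDpihalf addrC.
have -> : cos (pi / 2 - atan r) = sin (atan r).
  by rewrite -cosN opprB cosBpihalf.
by rewrite -[in LHS](atanK r) /tan invf_div.
Qed.

(** Unlike [c / |y|], the quotient [|y| / c] is continuous up to [y = 0], so this form shows that
    the value chosen at height 0 is the limit from above. *)
Lemma angleE c y : c != 0 ->
  angle c y = (if c < 0 then pi else 0) + atan (`|y| / c).
Proof.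
move=> c0; rewrite /angle; have [->|y0] := eqVneq y 0.
  by rewrite normr0 mul0r atan0 addr0 le_eqVlt (negPf c0).
have ypos : 0 < `|y| by rewrite normr_gt0.
have [cn|cp|/eqP] := ltgtP c 0; last by rewrite (negPf c0).
  have cVn : 0 < - c / `|y| by rewrite divr_gt0// oppr_gt0.
  have := atanV cVn; rewrite invf_div mulNr atanN invrN mulrN atanN; lra.
have cV : 0 < c / `|y| by rewrite divr_gt0.
by rewrite add0r -atanV// invf_div.
Qed.

Lemma continuous_angle_y c y : c != 0 -> {for y, continuous (angle c)}.
Proof.
move=> c0; rewrite (_ : angle c = fun y =>
  (if c < 0 then pi else 0) + atan (`|y| / c)); last first.
  by apply/funext => z; exact: angleE.
apply: cvgD; first exact: cvg_cst.
apply: continuous_comp; last exact: continuous_atan.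
apply: cvgMl; exact: norm_continuous.
Qed.

Lemma continuous_angle_x y c : y != 0 -> {for c, continuous (angle ^~ y)}.
Proof.
move=> y0; rewrite (_ : angle ^~ y = fun c => pi / 2 - atan (c / `|y|)); last first.
  by apply/funext => z; rewrite /angle (negPf y0).
apply: cvgB; first exact: cvg_cst.
apply: (@continuous_comp _ _ _ (fun c => c / `|y|)); last exact: continuous_atan.
by apply: cvgMl; exact: cvg_id.
Qed.

Lemma continuous_logmod_y c y : (c != 0) || (y != 0) ->
  {for y, continuous (logmod c)}.
Proof.
move=> cy; apply: cvgMl; apply: (@continuous_comp _ _ _ (fun y => c ^+ 2 + y ^+ 2)).
  by apply: cvgD; [exact: cvg_cst|exact: exprn_continuous].
by apply: continuous_ln; exact: sqr_sum_gt0.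
Qed.

Lemma continuous_logmod_x y c : (c != 0) || (y != 0) ->
  {for c, continuous (logmod ^~ y)}.
Proof.
move=> cy; apply: cvgMl; apply: (@continuous_comp _ _ _ (fun c => c ^+ 2 + y ^+ 2)).
  by apply: cvgD; [exact: exprn_continuous|exact: cvg_cst].
by apply: continuous_ln; exact: sqr_sum_gt0.
Qed.

Lemma measurable_logmod y (D : set R) : measurable D -> measurable_fun D (logmod ^~
  y).
Proof.
move=> mD; apply: measurable_funM => //; apply: measurableT_comp => //.
apply: measurable_funD => //; exact: measurable_funX.
Qed.

Lemma measurable_angle y (D : set R) : measurable D -> measurable_fun D (angle ^~ y).
Proof.
move=> mD; apply: (measurable_funS measurableT) => //.
rewrite /angle; case: eqP => [_|_].
  apply: measurable_fun_ifT => //; exact: measurable_fun_ler.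
apply: measurable_funB => //.
apply: (@measurableT_comp _ _ _ _ _ _ (@atan R)); last exact: measurable_funM.
by apply: continuous_measurable_fun; exact: continuous_atan.
Qed.

(** Identifies the argument used in [cln_lower] with the arctangent form, via
    [cos (atan r) = 1 / sqrt (1 + r^2)]. *)
Lemma acos_angle c y : 0 < y -> acos (c / Num.sqrt (c ^+ 2 + y ^+ 2)) = angle c y.
Proof.
move=> y0; rewrite -(cosK (x := angle c y)); last first.
  by rewrite in_itv/= angle_ge0 angle_le_pi.
congr acos; rewrite /angle gt_eqF// gtr0_norm//.
rewrite -cosN opprB cosBpihalf.
have := atanK (c / y); rewrite /tan => /(congr1 ( *%R^~ (cos (atan (c / y))))).
rewrite divfK; last by rewrite gt_eqF// cos_gt0_pihalf// atan_gtNpi2 atan_ltpi2.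
move=> ->; rewrite cos_atan -mulrA; congr (_ * _).
rewrite -invfM; congr (_^-1).
have -> : y * Num.sqrt (1 + (c / y) ^+ 2) = Num.sqrt (y ^+ 2) * Num.sqrt (1 + (c /
  y) ^+ 2).
  by rewrite sqrtr_sqr gtr0_norm.
rewrite -sqrtrM ?sqr_ge0//; congr Num.sqrt.
by rewrite mulrDr mulr1 expr_div_n mulrCA mulfV ?mulr1 1?addrC// gt_eqF// exprn_gt0.
Qed.

Lemma ln_sqrt_logmod c y : ln (Num.sqrt (c ^+ 2 + y ^+ 2)) = logmod c y.
Proof.
rewrite /logmod.
have [h|h] := ltP 0 (c ^+ 2 + y ^+ 2); last first.
  by rewrite (ler0_sqrtr h) ln0 ?ln0 ?mul0r//.
rewrite -{2}(sqr_sqrtr (ltW h)) lnXn ?sqrtr_gt0// mulr2n; lra.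
Qed.

(** [|c - d| |c + d| = c^2 - d^2 < c^2]: strict concavity of [ln |c|] on either side of 0. *)
Lemma logmod_midpoint c d : 0 < d -> d < `|c| ->
  logmod (c - d) 0 + logmod (c + d) 0 < logmod c 0 + logmod c 0.
Proof.
move=> d0 dc; have c0 : 0 < `|c| by rewrite (lt_trans d0).
have cN0 : c != 0 by rewrite -normr_gt0.
have cd : d ^+ 2 < c ^+ 2.
  by rewrite -(real_normK (num_real c)) ltr_pXn2r ?nnegrE ?ltW.
have m0 : 0 < `|c - d| * `|c + d|.
  by rewrite -normrM -subr_sqr normr_gt0 subr_eq0 gt_eqF.
have [h1 h2] : 0 < `|c - d| /\ 0 < `|c + d|.
  by split; rewrite lt_def normr_ge0 andbT; apply: contraTneq m0 => ->;
    rewrite ?(mul0r,mulr0) ltxx.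
rewrite !logmod0E -!lnM ?posrE// ltr_ln ?posrE ?mulr_gt0// -!normrM -subr_sqr.
have c2 : 0 < c ^+ 2 by rewrite lt_def sqrf_eq0 cN0 sqr_ge0.
by rewrite -expr2 !gtr0_norm ?subr_gt0// ltrBlDr ltrDl exprn_gt0.
Qed.

End Pointwise.

Local Notation borelR R := (measurableTypeR R).

(** * Potentials of a measure on [[-2, 2]] *)

Section PairClass.
Context {R : realType} (A : R) (dk : probability (measurableTypeR R) R).
Hypothesis Adk : pair_class A dk.

Let g (x : R) := fun t : borelR R => lne (Normc.normc (t%:C - x%:C)%C)%:E.

Let gE x (t : R) : g x t = lne (`|t - x|%R%:E).
Proof.
rewrite /g -rmorphB /Normc.normc /= expr0n/= addr0 sqrtr_sqr.
by [].
Qed.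

Lemma measurable_itv22 : measurable (@itv22 R : set (borelR R)).
Proof. exact: measurable_itv. Qed.

Let measurable_g x : measurable_fun (@itv22 R : set (borelR R)) (g x).
Proof.
have -> : g x = fun t : borelR R => if t == x then -oo%E else (logmod (t - x) 0)%:E.
  apply/funext => t; rewrite gE /lne normr_le0 subr_eq0 logmod0E.
  by [].
apply: (measurable_funS measurableT) => //.
apply: measurable_fun_ifT => //.
  exact: measurable_fun_eqr.
apply/measurable_EFinP.
apply: (@measurableT_comp _ _ _ _ _ _ (@logmod R ^~ 0)); last exact: measurable_funB.
by apply: measurable_logmod.
Qed.

(** The positive part is bounded, since the logarithm grows sublinearly. An infinite integral of the
    negative part would make the integral in [pair_class] at the real point [z = x] equal to
    [-oo]. *)
Let integrable_g x : dk.-integrable (@itv22 R) (g x).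
Proof.
have [A0 dk1 /(_ x%:C)] := Adk; rewrite -/(g x) => ge0.
have fp : (\int[dk]_(t in @itv22 R) (g x)^\+ t < +oo)%E.
  apply: (@le_lt_trans _ _ (\int[dk]_(t in @itv22 R) (cst (4 + `|x|)%:E) t)%E).
    apply: ge0_le_integral => //.
    - exact: measurable_itv22.
    - exact: measurable_funepos.
    - move=> t; rewrite /itv22/= in_itv/= => /andP[t1 t2].
      rewrite funeposE ge_max lee_fin addr_ge0// andbT.
      rewrite gE; apply: le_trans (ltW (lne_sublinear _)) _ => //.
      rewrite lee_fin (le_trans (ler_normB _ _))// lerD2r.
      by rewrite ler_norml; apply/andP; split; lra.
  rewrite (integral_cst dk measurable_itv22).
  by move: dk1 => /= ->; rewrite mule1 ltry.
have fn : (\int[dk]_(t in @itv22 R) (g x)^\- t < +oo)%E.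
  rewrite ltNge leye_eq; apply/negP => /eqP foo.
  move: ge0; rewrite integralE foo.
  move: fp; case: (\int[dk]_(t in @itv22 R) (g x)^\+ t)%E (integral_ge0 dk (D :=
    @itv22 R) (f := (g x)^\+%E) (fun t _ => funepos_ge0 (g x) t)) => [r| |]//=.
apply/integrableP; split => //.
rewrite -[fun t => _]/(abse \o g x) fune_abse ge0_integralD//.
- exact: lte_add_pinfty.
- exact: measurable_itv22.
- exact: measurable_funepos.
- exact: measurable_funeneg.
Qed.

Lemma pair_class_mass1 : dk (@itv22 R) = 1%E.
Proof. by have [] := Adk. Qed.

Lemma pair_class_setC22 : dk (~` @itv22 R) = 0%E.
Proof.
by rewrite probability_setC ?pair_class_mass1 ?subee//; exact: measurable_itv22.
Qed.

(** The kernel is [-oo] at [t = x], and an integrable function is finite almost everywhere. *)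
Lemma pair_class_atomless (x : R) : dk [set x] = 0%E.
Proof.
have [x22|x22] := pselect ((@itv22 R) x); last first.
  apply: (subset_measure0 _ _ _ pair_class_setC22) => //.
  - by apply: measurableC; exact: measurable_itv22.
  - by move=> t /= ->.
have [N [mN N0 sub]] := integrable_ae measurable_itv22 (integrable_g x).
apply: (subset_measure0 _ _ _ N0) => // t /= ->.
by apply: sub => /(_ x22); rewrite gE subrr normr0 /lne lexx.
Qed.

(** Passes from [lne] to a real-valued kernel; the two differ only at [t = x], where
    [logmod 0 0 = 0]. *)
Lemma pair_class_integrable_log (x : R) :
  dk.-integrable (@itv22 R) (fun t => (logmod (t - x) 0)%:E).
Proof.
apply: (le_integrable measurable_itv22 _ _ (integrable_g x)).
  apply/measurable_EFinP.
  apply: (@measurableT_comp _ _ _ _ _ _ (@logmod R ^~ 0));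
    last exact: measurable_funB.
  by apply: measurable_logmod.
move=> t _; rewrite gE logmod0E /lne normr_le0 subr_eq0.
by case: ifPn => [/eqP ->|]//; rewrite leey.
Qed.

End PairClass.

(** * A primitive of the logarithmic kernel and its increments *)

Section LogPrimitive.
Context {R : realType}.
Implicit Types (r s l M : R).

(* A primitive of [r |-> - ln `|r|], continuous at 0 because [0 * ln 0 = 0]. *)
Definition log_primitive r : R := r - r * ln `|r|.

Lemma log_primitiveN r : log_primitive (- r) = - log_primitive r.
Proof. by rewrite /log_primitive normrN; ring. Qed.

Lemma log_primitive0 : log_primitive 0 = 0.
Proof. by rewrite /log_primitive mul0r subr0. Qed.

Lemma ln_sub_le r1 r2 : 0 < r1 -> 0 < r2 -> r1 * (ln r2 - ln r1) <= r2 - r1.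
Proof.
move=> r10 r20; rewrite -ln_div ?posrE//.
have := @le_ln1Dx R (r2 / r1 - 1).
rewrite subrKC => /(_ _)H.
have {}H : ln (r2 / r1) <= r2 / r1 - 1 by apply: H; rewrite ltrBrDr addNr divr_gt0.
have := ler_wpM2l (ltW r10) H.
by rewrite mulrBr mulr1 mulrCA divff ?mulr1// gt_eqF.
Qed.

Let log_primitive_ge_pos r1 r2 M : 0 <= r1 -> r1 <= r2 -> r2 <= M ->
  - (r2 - r1) * ln M <= log_primitive r2 - log_primitive r1.
Proof.
move=> r10; rewrite le_eqVlt => /predU1P[->|r12] r2M.
  by rewrite !subrr oppr0 mul0r.
have r20 : 0 < r2 by exact: le_lt_trans r12.
have lM : ln r2 <= ln M by rewrite ler_ln// posrE (lt_le_trans r20).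
have : - (r2 - r1) * ln M <= - (r2 - r1) * ln r2.
  by rewrite ler_wnM2l// oppr_le0 subr_ge0 ltW.
move=> /le_trans; apply; rewrite /log_primitive !ger0_norm ?(ltW r20)//.
move: r10; rewrite le_eqVlt => /predU1P[<-|r10]; first by lra.
have := ln_sub_le r10 r20; lra.
Qed.

(** The derivative [- ln |r|] is at least [- ln M] for [|r| <= M]. The singularity at 0 is handled
    by treating each side apart, using oddness and the value 0 at 0. *)
Lemma log_primitive_ge r1 r2 M : r1 <= r2 -> `|r1| <= M -> `|r2| <= M ->
  - (r2 - r1) * ln M <= log_primitive r2 - log_primitive r1.
Proof.
move=> r12; rewrite !ler_norml => /andP[a1 a2] /andP[b1 b2].
have [r10|r10] := leP 0 r1; first exact: log_primitive_ge_pos.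
have [r20|r20] := leP r2 0.
  have := @log_primitive_ge_pos (- r2) (- r1) M.
  rewrite !log_primitiveN => h.
  have : - (- r1 - - r2) * ln M <= - log_primitive r1 - - log_primitive r2.
    by apply: h; lra.
  by rewrite (_ : - (- r1 - - r2) = - (r2 - r1)); [lra|ring].
have h1 : - (r2 - 0) * ln M <= log_primitive r2 - log_primitive 0.
  by apply: log_primitive_ge_pos => //; exact: ltW.
have h2 : - (- r1 - 0) * ln M <= log_primitive (- r1) - log_primitive 0.
  by apply: log_primitive_ge_pos; lra.
move: h1 h2; rewrite log_primitiveN log_primitive0 !mulNr !mulrBl; lra.
Qed.

Lemma log_primitive_le r1 r2 : 0 < r1 -> r1 <= r2 ->
  log_primitive r2 - log_primitive r1 <= - (r2 - r1) * ln r1.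
Proof.
move=> r10 r12; have r20 : 0 < r2 by exact: lt_le_trans r12.
have := ln_sub_le r20 r10; rewrite /log_primitive !gtr0_norm//; lra.
Qed.

Lemma normr_mul_ln_le r : `|r * ln `|r| | <= 1 + r ^+ 2.
Proof.
have [->|r0] := eqVneq r 0; first by rewrite mul0r normr0 addr_ge0 ?sqr_ge0.
have rp : 0 < `|r| by rewrite normr_gt0.
rewrite normrM -(real_normK (num_real r)); set s := `|r| in rp *.
have h1 : ln s <= s by exact/ltW/ln_sublinear.
have h2 : - ln s <= s^-1 by rewrite -lnV ?posrE//; apply/ltW/ln_sublinear;
  rewrite invr_gt0.
have h3 : s * s^-1 = 1 by rewrite divff// gt_eqF.
have sV : 0 < s^-1 by rewrite invr_gt0.
have h : `|ln s| <= s + s^-1 by rewrite ler_norml; apply/andP; split; lra.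
by rewrite (le_trans (ler_wpM2l (ltW rp) h))// mulrDr h3 expr2 addrC.
Qed.

Lemma log_primitive_bound r : `|log_primitive r| <= `|r| + 1 + r ^+ 2.
Proof.
by rewrite (le_trans (ler_normB _ _))// -addrA lerD2l normr_mul_ln_le.
Qed.

Lemma log_primitiveM l r : 0 < l ->
  log_primitive (l * r) = l * (log_primitive r - r * ln l).
Proof.
move=> l0; rewrite /log_primitive normrM gtr0_norm//.
have [->|r0] := eqVneq r 0; first by rewrite !(mulr0,mul0r) !subr0 mulr0.
by rewrite lnM ?posrE ?normr_gt0//; ring.
Qed.

(** This and the next two lemmas bound the integral of [- ln |x - s|] over [l <= x <= 2 l]. Here
    scaling to [l = 1] leaves [r = s / l] in []0, 4[], and 30 exceeds [4 + 7 + 13], the sum of the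
    bounds for [ln r] and for the two primitives. *)
Lemma log_primitive_near (l s : R) : 0 < l -> 0 < s -> s < 4 * l ->
  log_primitive (2 * l - s) - log_primitive (l - s) <= l * (- ln s + 30).
Proof.
move=> l0 s0 s4.
pose r := s / l.
have sE : s = l * r by rewrite /r mulrCA divff ?mulr1// gt_eqF.
have r0 : 0 < r by rewrite divr_gt0.
have r4 : r < 4 by rewrite ltr_pdivrMr.
have -> : 2 * l - s = l * (2 - r) by rewrite sE; ring.
have -> : l - s = l * (1 - r) by rewrite sE; ring.
rewrite !log_primitiveM// -mulrBr ler_pM2l// sE lnM ?posrE//.
have lnr : ln r < 4 by rewrite (lt_trans (ln_sublinear r0)).
have b2 : log_primitive (2 - r) <= 7.
  rewrite (le_trans (ler_norm _))// (le_trans (log_primitive_bound _))//.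
  have : `|2 - r| <= 2 by rewrite ler_norml; apply/andP; split; lra.
  have := real_normK (num_real (2 - r)); have := normr_ge0 (2 - r); nra.
have b1 : - log_primitive (1 - r) <= 13.
  rewrite -log_primitiveN (le_trans (ler_norm _))// (le_trans (log_primitive_bound
    _))//.
  have : `|- (1 - r)| <= 3 by rewrite ler_norml; apply/andP; split; lra.
  have := real_normK (num_real (- (1 - r))); have := normr_ge0 (- (1 - r)); nra.
lra.
Qed.

(** Over this range the integrand is at most [- ln (s - 2 l)], and [ln s - ln (s - 2 l) <= 2 l / (s
    - 2 l) <= 4 l / s] since [s >= 4 l]. *)
Lemma log_primitive_far (l s : R) : 0 < l -> 4 * l <= s ->
  log_primitive (2 * l - s) - log_primitive (l - s) <= l * (- ln s + 4 * l / s).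
Proof.
move=> l0 s4; have s0 : 0 < s by lra.
have := @log_primitive_le (s - 2 * l) (s - l).
rewrite -(opprB (2 * l)) -(opprB l) !log_primitiveN => h.
have {}h : - log_primitive (l - s) - - log_primitive (2 * l - s) <=
  - (- (l - s) - - (2 * l - s)) * ln (- (2 * l - s)) by apply: h; lra.
rewrite (_ : - (- (l - s) - - (2 * l - s)) = - l) in h; last by ring.
have h2 : 0 < - (2 * l - s) by lra.
have := ln_sub_le h2 s0.
have -> : s - - (2 * l - s) = 2 * l by ring.
move=> h3.
have h4 : ln s - ln (- (2 * l - s)) <= 4 * l / s.
  rewrite ler_pdivlMr//.
  have [d0|d0] := leP (ln s - ln (- (2 * l - s))) 0; first by nra.
  have : s <= 2 * - (2 * l - s) by lra.
  nra.
have := ler_wpM2l (ltW l0) h4; lra.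
Qed.

(** Every point of [[l, 2 l]] is at distance at least [|s|] from a negative [s]. *)
Lemma log_primitive_neg (l s : R) : 0 < l -> s < 0 ->
  log_primitive (2 * l - s) - log_primitive (l - s) <= - l * ln `|s|.
Proof.
move=> l0 s0.
have := @log_primitive_le (l - s) (2 * l - s).
have -> : - (2 * l - s - (l - s)) = - l by ring.
move=> /(_ _ _) h; apply: le_trans (h _ _) _; rewrite ?ltr_naddl //; try lra.
rewrite ler_wnM2l ?oppr_le0 ?(ltW l0)// ltr0_norm// ler_ln ?posrE; lra.
Qed.

End LogPrimitive.

(** * Logarithmic and angle potentials in the closed upper half plane *)

Section Potential.
Context {R : realType} (mu : probability (measurableTypeR R) R).
Implicit Types (x y t : R).

(** In the notation of the overview, [u] is [ln A - log_potential] and [v] is [angle_potential];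
    both are also used at height [y = 0]. *)
Definition log_potential x y : R :=
  \int[mu]_(t in @itv22 R) logmod (t - x) y.

Definition angle_potential x y : R :=
  \int[mu]_(t in @itv22 R) angle (t - x) y.

Local Notation D := (@itv22 R : set (borelR R)).
Local Notation U := log_potential.
Local Notation V := angle_potential.
Local Notation integ f := (mu.-integrable D (EFin \o (f : borelR R -> R))).

Hypothesis mu1 : mu itv22 = 1%E.
Hypothesis mu0 : forall x, mu [set x] = 0%E.
Hypothesis intlog : forall x,
  mu.-integrable itv22 (fun t => (logmod (t - x) 0)%:E).

Lemma itv22P t : D t -> -2 <= t <= 2.
Proof. by rewrite /itv22/= in_itv. Qed.

Lemma integrable_cst22 (k : R) : integ (fun=> k).
Proof. by apply: finite_measure_integrable_cst; exact: measurable_itv22. Qed.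

Lemma integrable_bounded22 (f : borelR R -> R) (M : R) : measurable_fun D f ->
  (forall t, D t -> `|f t| <= M) -> integ f.
Proof.
move=> mf fM; apply: (le_integrable measurable_itv22 _ _ (integrable_cst22 M)).
  exact/measurable_EFinP.
by move=> t Dt; rewrite /= lee_fin (le_trans (fM _ Dt))// ler_norm.
Qed.

Lemma measurable_logmodB x y : measurable_fun D (fun t : borelR R =>
  logmod (t - x) y).
Proof.
apply: (@measurableT_comp _ _ _ _ _ _ (@logmod R ^~ y)); last exact: measurable_funB.
by apply: measurable_logmod.
Qed.

Lemma measurable_angleB x y : measurable_fun D (fun t : borelR R => angle (t - x) y).
Proof.
apply: (@measurableT_comp _ _ _ _ _ _ (@angle R ^~ y)); last exact: measurable_funB.
by apply: measurable_angle.
Qed.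

Lemma logmod_bound (c d y : R) : y != 0 -> `|c| <= d ->
  `|logmod c y| <= `|logmod 0 y| + `|logmod d y|.
Proof.
move=> y0 cd.
have h1 : logmod 0 y <= logmod c y.
  by apply: ler_logmod; rewrite ?y0 ?orbT// expr0n/= add0r lerDr sqr_ge0.
have h2 : logmod c y <= logmod d y.
  apply: ler_logmod; rewrite ?y0 ?orbT// lerD2r -(real_normK (num_real c)).
  by rewrite ler_pXn2r ?nnegrE// (le_trans _ cd).
have := ler_norm (logmod d y); have := ler_norm (- logmod 0 y).
have := normr_ge0 (logmod 0 y); have := normr_ge0 (logmod d y).
rewrite normrN => a1 a2 a3 a4.
by rewrite ler_norml; apply/andP; split; lra.
Qed.

Lemma norm_sub22 x t : D t -> `|t - x| <= 2 + `|x|.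
Proof.
move=> /itv22P/andP[t1 t2]; rewrite (le_trans (ler_normB _ _))// lerD2r.
by rewrite ler_norml; apply/andP; split; lra.
Qed.

Lemma integrable_logmod x y : integ (fun t => logmod (t - x) y).
Proof.
have [->|y0] := eqVneq y 0; first exact: intlog.
apply: (integrable_bounded22 (measurable_logmodB _ _)) => t Dt.
exact: logmod_bound y0 (norm_sub22 _ Dt).
Qed.

Lemma integrable_angle x y : integ (fun t => angle (t - x) y).
Proof.
apply: (integrable_bounded22 (M := pi) (measurable_angleB _ _)) => t Dt.
by rewrite ger0_norm ?angle_ge0// angle_le_pi.
Qed.

(** The null set [N] absorbs the point [t = x], where the kernels are singular on the real axis;
    this is how the absence of atoms gives continuity up to the axis. *)
Lemma continuous_integral22 (f : R -> borelR R -> R) (a : R) (G : borelR R -> R)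
    (N : set (borelR R)) : (forall x, integ (f x)) -> integ G ->
  measurable N -> mu N = 0%E ->
  (forall t x, D t -> ~ N t -> a - 1 < x < a + 1 ->
    {for x, continuous (f ^~ t)} /\ `|f x t| <= G t) ->
  {for a, continuous (fun x => \int[mu]_(t in D) f x t)}.
Proof.
move=> intf intG mN N0 H.
apply: (@continuity_under_integral R _ _ mu f D measurable_itv22 (a - 1) (a + 1) _
  _ G intG).
- by [].
- exists N; split => // t /= h; apply: contrapT => Nt; apply: h => Dt x xI.
  by apply: (H t x Dt Nt _).1; move: xI; rewrite inE/= in_itv.
- move=> x xI; exists N; split => // t /= h; apply: contrapT => Nt; apply: h => Dt.
  by apply: (H t x Dt Nt _).2; move: xI; rewrite /= in_itv.
- by rewrite inE/= in_itv/= ltrBlDr ltrDl ltr01.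
Qed.

Let measurable_pt x : measurable ([set x] : set (borelR R)).
Proof. exact: measurable_set1. Qed.

(** For [t != x] the kernel increases with [|z|], so near [y] it lies between its values at heights
    0 and [|y| + 1], both integrable. *)
Lemma continuous_log_y x y : {for y, continuous (U x)}.
Proof.
have intG : integ (fun t => `|logmod (t - x) 0| + `|logmod (t - x) (`|y| + 1)|).
  have -> : EFin \o (fun t : borelR R =>
    `|logmod (t - x) 0| + `|logmod (t - x) (`|y| + 1)|)
    = ((EFin \o (Num.norm \o (fun t : borelR R => logmod (t - x) 0))) \+
      (EFin \o (Num.norm \o (fun t : borelR R => logmod (t - x) (`|y| + 1)))))%E.
    by apply/funext => t; rewrite /= EFinD.
  apply: (integrableD measurable_itv22); apply: integrable_norm;
    exact: integrable_logmod.
apply: (continuous_integral22 (integrable_logmod x) intG (measurable_pt x) (mu0 x)).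
move=> t z Dt tx /andP[z1 z2].
have c0 : t - x != 0 by rewrite subr_eq0; apply/eqP.
split; first by apply: continuous_logmod_y; rewrite c0.
have h1 : logmod (t - x) 0 <= logmod (t - x) z.
  by apply: ler_logmod; rewrite ?c0// expr0n/= addr0 lerDl sqr_ge0.
have h2 : logmod (t - x) z <= logmod (t - x) (`|y| + 1).
  apply: ler_logmod; rewrite ?c0// lerD2l -(real_normK (num_real z)).
  rewrite ler_pXn2r ?nnegrE ?addr_ge0// ler_norml.
  have := ler_norm y; have := ler_norm (- y); rewrite normrN => ? ?.
  by apply/andP; split; lra.
have := ler_norm (logmod (t - x) (`|y| + 1)).
have := ler_norm (- (logmod (t - x) 0)); rewrite normrN.
have := normr_ge0 (logmod (t - x) (`|y| + 1)).
have := normr_ge0 (logmod (t - x) 0).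
by rewrite ler_norml => ? ? ? ?; apply/andP; split; lra.
Qed.

Lemma continuous_angle_potential_y x y : {for y, continuous (V x)}.
Proof.
apply: (continuous_integral22 (integrable_angle x) (integrable_cst22 pi)
  (measurable_pt x) (mu0 x)).
move=> t z Dt tx _; split; last by rewrite ger0_norm ?angle_ge0 ?angle_le_pi.
by apply: continuous_angle_y; rewrite subr_eq0; apply/eqP.
Qed.

Lemma continuous_log_x y x : y != 0 -> {for x, continuous (U ^~ y)}.
Proof.
move=> y0.
apply: (continuous_integral22 (integrable_logmod ^~ y)
  (integrable_cst22 (`|logmod 0 y| + `|logmod (3 + `|x|) y|)) measurable0 (measure0
    _)).
move=> t z Dt _ /andP[z1 z2]; split.
  apply: (@continuous_comp _ _ _ (fun x => t - x) (logmod ^~ y)).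
    by apply: cvgB; [exact: cvg_cst|exact: cvg_id].
  by apply: continuous_logmod_x; rewrite y0 orbT.
apply: logmod_bound => //; rewrite (le_trans (norm_sub22 _ Dt))//.
have : `|z| <= `|x| + 1; last by move=> ?; lra.
have -> : z = x + (z - x) by ring.
rewrite (le_trans (ler_normD _ _))// lerD2l ler_norml; apply/andP; split; lra.
Qed.

Lemma continuous_angle_potential_x y x : y != 0 -> {for x, continuous (V ^~ y)}.
Proof.
move=> y0.
apply: (continuous_integral22 (integrable_angle ^~ y)
  (integrable_cst22 pi) measurable0 (measure0 _)).
move=> t z Dt _ _; split; last by rewrite ger0_norm ?angle_ge0 ?angle_le_pi.
apply: (@continuous_comp _ _ _ (fun x => t - x) (angle ^~ y)).
  by apply: cvgB; [exact: cvg_cst|exact: cvg_id].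
exact: continuous_angle_x.
Qed.

Let Uint := integrable_logmod.
Let Vint := integrable_angle.

Lemma Rintegral_gt0_22 (f : borelR R -> R) : integ f ->
  (exists N, [/\ measurable (N : set (borelR R)), mu N = 0%E &
    forall t, D t -> ~ N t -> 0 < f t]) ->
  0 < \int[mu]_(t in D) f t.
Proof.
move=> intf [N [mN N0 f0]].
have mD := @measurable_itv22 R.
have mDN : measurable (D `\` N) by exact: measurableD.
have muDN : mu (D `\` N) <> 0%E.
  move=> DN0; have : (mu D <= mu ((D `\` N) `|` N))%E.
    apply: le_measure; rewrite ?inE//; first exact: measurableU.
    by move=> t Dt; have [|] := pselect (N t); [right|left].
  move=> /le_trans/(_ (measureU2 _ mDN mN));
    rewrite [mu D]mu1 [X in (_ <= X + _)%E]DN0 [X in (_ <= _ + X)%E]N0.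
  by rewrite adde0 lee_fin ler10.
have Hf : \int[mu]_(t in D) f t = \int[mu]_(t in D `\` N) f t.
  by rewrite /Rintegral (negligible_integral mN).
rewrite Hf lt_def Rintegral_ge0 ?andbT; last by move=> t [Dt Nt]; exact/ltW/f0.
apply/negP => /eqP I0.
have intf' : mu.-integrable (D `\` N) (EFin \o f).
  exact: integrableS intf.
have If0 : (\int[mu]_(t in D `\` N) (f t)%:E = 0)%E.
  rewrite -[LHS]fineK; last exact: integrable_fin_num.
  by congr EFin.
have mf : measurable_fun (D `\` N) (EFin \o f) by exact: measurable_int intf'.
have Iabs : (\int[mu]_(t in D `\` N) `|(EFin \o f) t| = 0)%E.
  rewrite -If0; apply: eq_integral => t; rewrite inE => -[Dt Nt].
  by rewrite gee0_abs// lee_fin; exact/ltW/f0.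
have [/(_ Iabs) [M [mM M0 sub]] _] := ae_eq_integral_abs mu mDN mf.
apply: muDN; apply: (subset_measure0 _ _ _ M0) => // t [Dt Nt].
apply: sub => /= /(_ (conj Dt Nt)) [ft0].
by have := f0 t Dt Nt; rewrite ft0 ltxx.
Qed.

Lemma le_Rintegral_null (f g : borelR R -> R) (N : set (borelR R)) :
  integ f -> integ g -> measurable N -> mu N = 0%E ->
  (forall t, D t -> ~ N t -> f t <= g t) ->
  \int[mu]_(t in D) f t <= \int[mu]_(t in D) g t.
Proof.
move=> intf intg mN N0 fg; have mD := @measurable_itv22 R.
have E (h : borelR R -> R) : integ h ->
    \int[mu]_(t in D) h t = \int[mu]_(t in D `\` N) h t.
  by move=> inth; rewrite /Rintegral (negligible_integral mN).
have mDN : measurable (D `\` N) by exact: measurableD.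
rewrite !E//; apply: le_Rintegral => //.
- exact: integrableS intf.
- exact: integrableS intg.
- by move=> t [Dt Nt]; exact: fg.
Qed.

Lemma potential_mono_gt0 x1 y1 x2 y2 : 0 < y1 -> 0 < y2 ->
  0 <= (V x1 y1 - V x2 y2) * (x1 - x2) + (U x1 y1 - U x2 y2) * (y1 - y2).
Proof.
move=> y10 y20.
have mD := @measurable_itv22 R.
have iV : integ (fun t => angle (t - x1) y1 - angle (t - x2) y2).
  by apply: (@integrableB _ _ _ mu D mD (fun t => (angle (t - x1) y1)%:E) (fun t =>
    (angle (t - x2) y2)%:E)); exact: Vint.
have iU : integ (fun t => logmod (t - x1) y1 - logmod (t - x2) y2).
  by apply: (@integrableB _ _ _ mu D mD (fun t =>
    (logmod (t - x1) y1)%:E) (fun t => (logmod (t - x2) y2)%:E)); exact: Uint.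
have iV' : integ (fun t => (angle (t - x1) y1 - angle (t - x2) y2) * (x1 - x2)).
  exact: (integrableZr mD (x1 - x2) iV).
have iU' : integ (fun t => (logmod (t - x1) y1 - logmod (t - x2) y2) * (y1 - y2)).
  exact: (integrableZr mD (y1 - y2) iU).
rewrite /V /U -(RintegralB mD (Vint _ _) (Vint _ _)) -(RintegralB mD (Uint _ _)
  (Uint _ _)).
rewrite -(RintegralZr _ mD iV) -(RintegralZr _ mD iU) -(RintegralD mD iV' iU').
apply: Rintegral_ge0 => t _.
by have := logmod_angle_mono (t - x1) (t - x2) y10 y20;
  rewrite [t - x2 - _](_ : _ = x1 - x2); [|ring].
Qed.

(** Both points are raised by the same [s > 0], which leaves [y1 - y2] unchanged, and [s] tends to
    0. *)
Lemma potential_mono x1 y1 x2 y2 : 0 <= y1 -> 0 <= y2 ->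
  0 <= (V x1 y1 - V x2 y2) * (x1 - x2) + (U x1 y1 - U x2 y2) * (y1 - y2).
Proof.
move=> y10 y20.
pose E s := (V x1 (y1 + s) - V x2 (y2 + s)) * (x1 - x2) + (U x1 (y1 + s) - U x2 (y2
  + s)) * (y1 - y2).
have cE : E s @[s --> 0] --> E 0.
  have sh (f : R -> R) y : {for y,
    continuous f} -> f (y + s) @[s --> 0] --> f (y + 0).
    move=> cf; apply: (@continuous_comp _ _ _ (fun s => y + s) f);
      last by rewrite addr0.
    by apply: cvgD; [exact: cvg_cst|exact: cvg_id].
  apply: cvgD; apply: cvgMl; apply: cvgB; apply: sh;
    [exact: continuous_angle_potential_y|exact: continuous_angle_potential_y|
     exact: continuous_log_y|exact: continuous_log_y].
have cE' : E s @[s --> 0^'+] --> E 0 by exact: cvg_at_right_filter.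
have : 0 <= E 0.
  rewrite -(cvg_lim _ cE')//; apply: limr_ge; first by apply/cvg_ex; exists (E 0).
  near=> s; have s0 : 0 < s by near: s; exact: nbhs_right_gt.
  rewrite /E.
  have -> : y1 - y2 = (y1 + s) - (y2 + s) by ring.
  by apply: potential_mono_gt0; exact: ltr_wpDl.
by rewrite /E !addr0.
Unshelve. all: by end_near. Qed.

Lemma log_potential_le x y y' : 0 <= y -> y <= y' -> U x y <= U x y'.
Proof.
move=> y0; rewrite le_eqVlt => /predU1P[->//|yy'].
have := potential_mono x x y0 (ltW (le_lt_trans y0 yy')).
by rewrite subrr mulr0 add0r nmulr_lge0 ?subr_lt0// subr_le0.
Qed.

Lemma angle_potential_le x x' y : 0 <= y -> x <= x' -> V x y <= V x' y.
Proof.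
move=> y0; rewrite le_eqVlt => /predU1P[->//|xx'].
have := potential_mono x x' y0 y0.
by rewrite subrr mulr0 addr0 nmulr_lge0 ?subr_lt0// subr_le0.
Qed.

Lemma Rintegral_cst22 (k : R) : \int[mu]_(t in D) k = k.
Proof. rewrite (Rintegral_cst mu (@measurable_itv22 R)) -[RHS]mulr1; congr (_ * _).
exact: (congr1 fine mu1). Qed.

Lemma angle_potential_gt0 x y : y != 0 -> 0 < V x y.
Proof.
move=> y0; apply: (Rintegral_gt0_22 (Vint _ _)); exists set0; split => // t _ _.
exact: angle_gt0.
Qed.

Lemma angle_potential_lt_pi x y : y != 0 -> V x y < pi.
Proof.
move=> y0; rewrite -subr_gt0 -{1}(Rintegral_cst22 pi) -(RintegralB
  (@measurable_itv22 R) (integrable_cst22 _) (Vint _ _)).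
apply: Rintegral_gt0_22.
  by apply: (@integrableB _ _ _ mu D (@measurable_itv22 R) (cst pi%:E) (fun t =>
    (angle (t - x) y)%:E)); [exact: integrable_cst22|exact: Vint].
by exists set0; split => // t _ _; rewrite subr_gt0; exact: angle_lt_pi.
Qed.

Lemma angle_potential_le_pihalf x y : x < -2 -> V x y <= pi / 2.
Proof.
move=> x2; rewrite -(Rintegral_cst22 (pi / 2)).
apply: (le_Rintegral (@measurable_itv22 R) (Vint _ _) (integrable_cst22 _)) =>
  t /itv22P/andP[t1 t2].
by apply/ltW/angle_lt_pihalf; rewrite subr_gt0; lra.
Qed.

Lemma angle_potential_ge_pihalf x y : 2 < x -> pi / 2 <= V x y.
Proof.
move=> x2; rewrite -(Rintegral_cst22 (pi / 2)).
apply: (le_Rintegral (@measurable_itv22 R) (integrable_cst22 _) (Vint _ _)) =>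
  t /itv22P/andP[t1 t2].
by apply/ltW/angle_gt_pihalf; rewrite subr_lt0; lra.
Qed.

(** At height 0 the angle is [pi] for [t <= x] and 0 otherwise. *)
Lemma angle_potential0 x : V x 0 = pi * fine (mu (D `&` [set t : borelR R | t <= x])).
Proof.
have mx : measurable [set t : borelR R | t <= x].
  by rewrite (_ : [set t | _] = `]-oo, x]%classic)//; apply/seteqP; split => t /=;
    rewrite in_itv.
rewrite /V /Rintegral.
rewrite (eq_integral (EFin \o ((fun=> pi) \_ [set t : borelR R | t <= x])));
  last first.
  move=> t _; rewrite /angle eqxx subr_le0 /patch /=.
  by case: ifPn => tx; [rewrite mem_set|rewrite memNset//; exact/negP].
rewrite -restrict_EFin -integral_mkcondr integral_cst;
  last by apply: measurableI => //; exact: measurable_itv22.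
by rewrite fineM// fin_num_measure//; apply: measurableI => //;
  exact: measurable_itv22.
Qed.

Lemma small_ball x (e : R) : 0 < e -> exists2 r : R, 0 < r &
  fine (mu `[x - r, x + r]%classic) < e.
Proof.
move=> e0.
pose F (n : nat) : set (borelR R) := `[x - n.+1%:R^-1, x + n.+1%:R^-1]%classic.
have Fx : \bigcap_n F n = [set x].
  apply/seteqP; split => [t Ft|t -> n _]; last first.
    by rewrite /F/= in_itv/= lerBlDr !lerDl invr_ge0 ler0n.
  apply: contrapT => /eqP; rewrite -subr_eq0 -normr_gt0 => tx.
  have [n nlt] := ltr_add_invr tx.
  have := Ft n I; rewrite /F/= in_itv/= => /andP[h1 h2].
  move: nlt; rewrite add0r; apply/negP; rewrite -leNgt ler_norml.
  by rewrite lerBrDr addrC h1 lerBlDl h2.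
have mF n : measurable (F n) by exact: measurable_itv.
have H : mu \o F @ \oo --> mu (\bigcap_n F n).
  apply: nonincreasing_cvg_mu => //.
  - by rewrite (le_lt_trans (probability_le1 _ _))// ltry.
  - by rewrite Fx; exact: measurable_set1.
  - move=> m n mn; apply/subsetPset => t; rewrite /F/= !in_itv/= => /andP[h1 h2].
    have nm : n.+1%:R^-1 <= m.+1%:R^-1 :> R by rewrite lef_pV2 ?posrE// ler_nat ltnS.
    by rewrite (le_trans _ h1) ?(le_trans h2)// ?lerD2l// lerN2.
have {}H : mu \o F @ \oo --> (0:R)%:E.
  by move: H; rewrite Fx; have := mu0 x => /= ->.
have /fine_cvg/cvgrPdist_lt/(_ _ e0)[n _ /(_ n (leqnn n))] := H.
rewrite /= sub0r normrN ger0_norm ?fine_ge0// => lte.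
by exists n.+1%:R^-1 => //; rewrite invr_gt0.
Qed.

(** Formally a primitive of [x |-> - log_potential x 0]; its increments stand for averages of that
    function and are estimated one [t] at a time. *)
Definition log_primitive_potential x : R :=
  \int[mu]_(t in @itv22 R) log_primitive (x - t).
Local Notation P := log_primitive_potential.

Lemma measurable_log_primitive : measurable_fun [set: borelR R] (@log_primitive R :
  borelR R -> R).
Proof.
apply: measurable_funB => //; apply: measurable_funM => //.
exact: measurableT_comp.
Qed.

Lemma integrable_log_primitive x : integ (fun t => log_primitive (x - t)).
Proof.
apply: (integrable_bounded22 (M := (2 + `|x|) + 1 + (2 + `|x|) ^+ 2)).
  apply: (measurableT_comp measurable_log_primitive); exact: measurable_funB.
move=> t Dt; have h := norm_sub22 x Dt; rewrite distrC in h.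
rewrite (le_trans (log_primitive_bound _))// lerD ?lerD//.
by rewrite -(real_normK (num_real (x - t))) ler_pXn2r ?nnegrE// addr_ge0.
Qed.

Lemma log_primitive_potentialB x1 x2 :
  P x2 - P x1 = \int[mu]_(t in D) (log_primitive (x2 - t) - log_primitive (x1 - t)).
Proof.
by rewrite (RintegralB (@measurable_itv22 R) (integrable_log_primitive _)
  (integrable_log_primitive _)).
Qed.

Let Pint := integrable_log_primitive.

Lemma integrableB22 (f g : borelR R -> R) : integ f -> integ g -> integ (fun t =>
  f t - g t).
Proof. exact: (@integrableB _ _ _ mu D (@measurable_itv22 R) (EFin \o f) (EFin \o
  g)). Qed.

Lemma integrableD22 (f g : borelR R -> R) : integ f -> integ g -> integ (fun t =>
  f t + g t).
Proof. exact: (@integrableD _ _ _ mu D (@measurable_itv22 R) (EFin \o f) (EFin \o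
  g)). Qed.

Lemma integrableZ22 (k : R) (f : borelR R -> R) : integ f -> integ (fun t => k * f t).
Proof. exact: (@integrableZl _ _ _ mu D (@measurable_itv22 R) k (EFin \o f)). Qed.

(* Sampling the potential slightly above the real axis bounds the increments of P
   from below without differentiating P or exchanging integrals. *)
Lemma log_primitive_potential_ge x1 x x2 : x1 <= x -> x <= x2 -> x1 < x2 ->
  - (x2 - x1) * U x (Num.sqrt (2 * (2 + `|x|) * (x2 - x1) + (x2 - x1) ^+ 2))
  <= P x2 - P x1.
Proof.
(* The height [y] is chosen so that [(|t - x| + d)^2 <= |t - x|^2 + y^2] for all [t] in [[-2, 2]],
   where [|t - x| <= 2 + |x|]. *)
move=> x1x xx2 x12; set y := Num.sqrt _; set d := x2 - x1 in y *.
have d0 : 0 < d by rewrite subr_gt0.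
have y2 : y ^+ 2 = 2 * (2 + `|x|) * d + d ^+ 2.
  rewrite sqr_sqrtr//; apply: addr_ge0; last exact: sqr_ge0.
  by rewrite mulr_ge0 ?(ltW d0)// mulr_ge0// addr_ge0.
rewrite log_primitive_potentialB /U -(RintegralZl _ (@measurable_itv22 R) (Uint _ _)).
apply: (le_Rintegral (@measurable_itv22 R) (integrableZ22 _ (Uint _ _))
  (integrableB22 (Pint _) (Pint _))).
move=> t Dt.
have bM (z : R) : x1 <= z -> z <= x2 -> `|z - t| <= `|t - x| + d.
  move=> h1 h2; rewrite (_ : z - t = (x - t) + (z - x)); last by ring.
  rewrite (le_trans (ler_normD _ _))// distrC lerD2l ler_norml /d.
  by apply/andP; split; lra.
have := @log_primitive_ge R (x1 - t) (x2 - t) (`|t - x| + d).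
rewrite (_ : x2 - t - (x1 - t) = d); last by rewrite /d; ring.
move=> /(_ _ _ _) h; apply: le_trans (h _ _ _); last 3 first.
- by rewrite lerD2r ltW.
- by apply: bM => //; exact: ltW.
- by apply: bM => //; exact: ltW.
rewrite !mulNr lerN2 ler_pM2l//.
have M0 : 0 < `|t - x| + d by rewrite ltr_wpDl.
have -> : ln (`|t - x| + d) = logmod (`|t - x| + d) 0 by rewrite logmod0E
  (gtr0_norm M0).
apply: ler_logmod; first by rewrite gt_eqF.
rewrite expr0n/= addr0 y2 sqrrD -(real_normK (num_real (t - x))).
have := norm_sub22 x Dt; nra.
Qed.

(* Real induction on the endpoint: every s in [a, b] has a neighbourhood in which
   the increments of P around s are large enough. *)
Lemma log_primitive_potential_increment a b c : a < b ->
  (forall x, a <= x <= b -> c < - U x 0) -> c * (b - a) <= P b - P a.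
Proof.
move=> ab H.
have loc s : a <= s <= b -> exists2 d, 0 < d & forall x1 x2,
  x1 <= s -> s <= x2 -> x1 < x2 ->
    x2 - x1 < d -> c * (x2 - x1) <= P x2 - P x1.
  move=> /H cs.
  have /cvgrPdist_lt/(_ (- U s 0 - c)) := @continuous_log_y s 0.
  rewrite subr_gt0 => /(_ cs)[d /= d0 dH].
  (* For [x2 - x1 < min 1 e] the sampling height is below [d]: at [x = s] its square is
     [(x2 - x1) (2 (2 + |s|) + (x2 - x1))]. *)
  pose e := d ^+ 2 / (2 * (2 + `|s|) + 1).
  have K0 : 0 < 2 * (2 + `|s|) + 1 by have := normr_ge0 s; lra.
  have e0 : 0 < e by rewrite divr_gt0 ?exprn_gt0.
  exists (Num.min 1 e); first by rewrite lt_min ltr01.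
  move=> x1 x2 x1s sx2 x12; rewrite lt_min => /andP[l1 le].
  apply: le_trans (log_primitive_potential_ge x1s sx2 x12).
  rewrite mulNr mulrC -mulrN ler_pM2l ?subr_gt0//.
  set y := Num.sqrt _.
  have y0 : 0 <= y by exact: sqrtr_ge0.
  have yd : y < d.
    rewrite -(ltr_pXn2r (n := 2)) ?nnegrE// ?(ltW d0)// sqr_sqrtr; last first.
      apply: addr_ge0; last exact: sqr_ge0.
      by rewrite mulr_ge0 ?subr_ge0 ?(ltW x12)// mulr_ge0// addr_ge0.
    move: le; rewrite ltr_pdivlMr// => le.
    apply: le_lt_trans le.
    have p0 : 0 < x2 - x1 by rewrite subr_gt0.
    nra.
  have := dH y; rewrite /ball_/= sub0r normrN ger0_norm// => /(_ yd).
  by rewrite ltr_norml => /andP[+ _]; lra.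
pose S := [set x | a <= x <= b /\ c * (x - a) <= P x - P a].
have Sa : S a by rewrite /S/= lexx ltW//= !subrr mulr0.
have hS : has_sup S by split; [exists a|exists b => x [/andP[_]]].
have sb : sup S <= b by apply: ge_sup; [exists a|move=> x [/andP[_]]].
have sa : a <= sup S by apply: ub_le_sup => //; case: hS.
have [|d d0 dH] := loc (sup S); first by rewrite sa sb.
have [x1 Sx1 x1s] := sup_adherent (divr_gt0 d0 (ltr0n R 2)) hS.
have x1S : x1 <= sup S by apply: ub_le_sup => //; case: hS.
have [/andP[ax1 x1b] Px1] := Sx1.
(* Stepping from [x1], within [d / 2] of [sup S], to [x2] keeps the inequality, so [x2 <= sup S];
   this is possible only if [x2 = b]. *)
pose x2 := Num.min b (sup S + d / 2).
have x2b : x2 <= b by rewrite ge_min lexx.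
have sx2 : sup S <= x2 by rewrite le_min sb lerDl divr_ge0// ltW.
have Sx2 : S x2.
  split; first by rewrite x2b (le_trans sa).
  have [x12|] := ltP x1 x2; last by move=> h; have -> : x2 = x1 by apply/le_anti;
    rewrite h (le_trans x1S).
  have h : x2 <= sup S + d / 2 by rewrite ge_min lexx orbT.
  by have := dH x1 x2 x1S sx2 x12 => /(_ _) H1; have {}H1 := H1 ltac:(lra); lra.
have x2S : x2 <= sup S by apply: ub_le_sup => //; case: hS.
have bx2 : b <= x2.
  have [h|/ltW h] := leP b (sup S + d / 2); first by rewrite /x2 (min_idPl h).
  by move: x2S; rewrite /x2 (min_idPr h) gerDl leNgt divr_gt0.
have bE : b = x2 by apply/le_anti; rewrite bx2 x2b.
by rewrite [X in X - a]bE [X in P X - _]bE; case: Sx2.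
Qed.

(* The mean of [- ln `|x - t|] over [x] between [x0 + s l] and [x0 + s (2 l)] exceeds
   [- ln `|x0 - t|] by at most 30, and by little if [`|t - x0|] is large compared to
   [l]; the remaining [t] have small measure since there are no atoms. *)
Lemma log_primitive_potential_le x0 s e : s = 1 \/ s = -1 -> 0 < e ->
  \forall l \near 0^'+, s * (P (x0 + s * (2 * l)) - P (x0 + s * l)) <= l * (- U x0
    0 + e).
Proof.
move=> s1 e0.
(* The error 30 on a ball of measure below [e / 60] costs at most [e / 2]. *)
have [k k0 kH] := @small_ball x0 (e / 60) (divr_gt0 e0 (ltr0n R 60)).
near=> l.
have l0 : 0 < l by near: l; exact: nbhs_right_gt.
have lk : 8 * l < k by rewrite -ltr_pdivlMl//; near: l; apply: nbhs_right_lt;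
  rewrite mulr_gt0 ?invr_gt0.
have le8 : 8 * l < e * k by rewrite -ltr_pdivlMl//; near: l; apply: nbhs_right_lt;
  rewrite !mulr_gt0 ?invr_gt0.
have mB : measurable (`[x0 - k,
  x0 + k]%classic : set (borelR R)) by exact: measurable_itv.
pose B := (`[x0 - k, x0 + k]%classic : set (borelR R)).
have i1B : integ (fun t : borelR R => (\1_B t : R)).
  apply: (integrable_bounded22 (M := 1)); first exact: measurable_indic.
  by move=> t _; rewrite ger0_norm// indicE lern1 leq_b1.
have iB := integrableZ22 30 i1B.
have i1 := integrableD22 (integrableZ22 (-1) (Uint x0 0)) (integrableD22
  (integrable_cst22 (e / 2)) iB).
(* Majorant of the increment for each [t]: the error 30 is charged on the ball [B] only, [e / 2]
   everywhere. *)
pose G (t : borelR R) := l * (-1 * logmod (t - x0) 0 + (e / 2 + 30 * (\1_B t : R))).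
have iG : integ G := integrableZ22 l i1.
have IG : \int[mu]_(t in D) G t <= l * (- U x0 0 + e).
  rewrite /G (RintegralZl _ (@measurable_itv22 R) i1) ler_pM2l//.
  rewrite (RintegralD (@measurable_itv22 R) (integrableZ22 (-1) (Uint x0 0))
    (integrableD22 (integrable_cst22 (e / 2)) iB)).
  rewrite (RintegralD (@measurable_itv22 R) (integrable_cst22 (e / 2)) iB)
    Rintegral_cst22.
  rewrite (RintegralZl _ (@measurable_itv22 R) (Uint x0 0)) mulN1r lerD2l.
  rewrite (RintegralZl _ (@measurable_itv22 R) i1B).
  have -> : \int[mu]_(t in D) (\1_B t : R) = fine (mu (B `&` D)).
    by rewrite /Rintegral integral_indic//; exact: measurable_itv22.
  have : fine (mu (B `&` D)) <= fine (mu B).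
    apply: fine_le; rewrite ?fin_num_measure//;
      [|exact: measurableI (@measurable_itv22 R)..|].
    - exact: measurableI (@measurable_itv22 R).
    - by apply: le_measure; rewrite ?inE//; exact: measurableI (@measurable_itv22 R).
  have : fine (mu B) < e / 60 by exact: kH.
  by move=> h1 h2; lra.
apply: le_trans IG.
rewrite log_primitive_potentialB -(RintegralZl _ (@measurable_itv22 R)
  (integrableB22 (Pint _) (Pint _))).
apply: (le_Rintegral_null (N := [set x0])) => //.
  exact: integrableZ22 (integrableB22 (Pint _) (Pint _)).
(* [r] is the distance from [x0] to [t], counted positively on the side [s]; by oddness both sides
   reduce to the interval [[l, 2 l]]. *)
move=> t Dt /eqP tx0; pose r := s * (t - x0).
have qs z : s * log_primitive z = log_primitive (s * z).
  by case: (s1) => ->; rewrite ?mul1r// !mulN1r log_primitiveN.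
have rE : `|r| = `|t - x0|.
  by rewrite /r normrM; case: (s1) => ->; rewrite ?normrN normr1 mul1r.
have ss : s * s = 1 by case: (s1) => ->; ring.
rewrite mulrBr !qs.
have -> : s * (x0 + s * (2 * l) - t) = 2 * l - r.
  by rewrite /r -[2 * l in RHS]mul1r -ss; ring.
have -> : s * (x0 + s * l - t) = l - r.
  by rewrite /r -[l in RHS]mul1r -ss; ring.
rewrite /G logmod0E -rE mulN1r.
have ind0 : 0 <= 30 * (\1_B t : R) by rewrite mulr_ge0.
have r0 : r != 0 by rewrite -normr_eq0 rE normr_eq0 subr_eq0.
have [rn|rp|/eqP] := ltgtP r 0; last by rewrite (negPf r0).
  apply: le_trans (log_primitive_neg l0 rn) _.
  by rewrite mulNr -mulrN ler_pM2l// lerDl; lra.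
have inB : r <= k -> (\1_B t : R) = 1.
  move=> rk; rewrite indicE mem_set// /B/= in_itv/=.
  have : `|t - x0| <= k by rewrite -rE gtr0_norm.
  by rewrite ler_norml lerBrDr lerBlDr addrC [k + _]addrC.
rewrite [`|r|]gtr0_norm//.
have [r4|r4] := ltP r (4 * l).
  apply: le_trans (log_primitive_near l0 rp r4) _.
  by rewrite ler_pM2l// lerD2l inB; lra.
apply: le_trans (log_primitive_far l0 r4) _.
rewrite ler_pM2l// lerD2l.
have [rk|rk] := leP r k.
  rewrite inB// ler_pdivrMr//; nra.
rewrite (le_trans (y := e / 2))// ?lerDl// ler_pdivrMr//; nra.
Unshelve. all: by end_near. Qed.

(** Otherwise [- U] exceeds [- U x0 0 + e] at all distances between [l] and [2 l] from [x0] on the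
    side [s]. The increment of the primitive there is then at least [l (- U x0 0 + e)], against the
    upper bound with [e / 2]. *)
Lemma log_potential_approach x0 s e d : s = 1 \/ s = -1 -> 0 < e -> 0 < d ->
  exists2 x, 0 < s * (x - x0) < d & U x0 0 - e <= U x 0.
Proof.
move=> s1 e0 d0.
have e20 : 0 < e / 2 by rewrite divr_gt0.
near (0 : R)^'+ => l.
have l0 : 0 < l by near: l; exact: nbhs_right_gt.
have ld : 2 * l < d by rewrite -ltr_pdivlMl//; near: l; apply: nbhs_right_lt;
  rewrite mulr_gt0 ?invr_gt0.
have : s * (P (x0 + s * (2 * l)) - P (x0 + s * l)) <= l * (- U x0 0 + e / 2).
  by near: l; exact: log_primitive_potential_le.
move=> H; apply: contrapT => nex.
have nex' x : 0 < s * (x - x0) < d -> - U x0 0 + e < - U x 0.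
  move=> h; rewrite ltNge; apply/negP => h2; apply: nex; exists x => //; lra.
have [a [b [ab bal abH PE]]] : exists a b, [/\ a < b, b - a = l,
    forall x, a <= x <= b -> l <= s * (x - x0) <= 2 * l &
    s * (P (x0 + s * (2 * l)) - P (x0 + s * l)) = P b - P a].
  case: (s1) => ->.
    exists (x0 + l), (x0 + 2 * l); split; [lra|lra| |by rewrite !mul1r].
    by move=> x /andP[? ?]; apply/andP; split; lra.
  exists (x0 - 2 * l), (x0 - l); split; [lra|lra| |].
    by move=> x /andP[? ?]; apply/andP; split; lra.
  by rewrite !mulN1r opprB.
have := log_primitive_potential_increment (c := - U x0 0 + e) ab.
rewrite -PE bal => H2.
have {}H2 : (- U x0 0 + e) * l <= s * (P (x0 + s * (2 * l)) - P (x0 + s * l)).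
  apply: H2 => x /abH /andP[h1 h2]; apply: nex'; apply/andP; split; lra.
nra.
Unshelve. all: by end_near. Qed.

(** For each [t] outside [[p, q]], that is, for almost every [t], [ln |t - x|] is strictly concave
    in [x] between [p] and [q]. *)
Lemma log_potential_midpoint p q : p < q -> mu `[p, q]%classic = 0%E ->
  U p 0 + U q 0 < U ((p + q) / 2) 0 + U ((p + q) / 2) 0.
Proof.
move=> pq mu0pq; set m := (p + q) / 2; have mD := @measurable_itv22 R.
rewrite -subr_gt0 -!(RintegralD mD) -?(RintegralB mD); try exact: Uint;
  try (apply: integrableD22; exact: Uint).
apply: Rintegral_gt0_22.
  by apply: integrableB22; apply: integrableD22; exact: Uint.
exists (`[p, q]%classic : set (borelR R)); split;
  [exact: measurable_itv|exact: mu0pq|].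
move=> t Dt Nt; rewrite subr_gt0.
pose d := (q - p) / 2.
have -> : t - p = (t - m) + d :> R by rewrite /m /d; field.
have -> : t - q = (t - m) - d :> R by rewrite /m /d; field.
rewrite [ltLHS]addrC; apply: logmod_midpoint; first by rewrite divr_gt0 ?subr_gt0.
rewrite ltNge ler_norml; apply/negP => /andP[h1 h2]; apply: Nt.
rewrite /= in_itv/= -(lerD2r (- m)) -[X in _ && X](lerD2r (- m)).
apply/andP; split; [apply: le_trans h1|apply: le_trans h2 _]; rewrite /m /d; lra.
Qed.

(** * Gaps and level sets of the distribution function *)

Lemma mu_setC22 : mu (~` @itv22 R) = 0%E.
Proof.
by rewrite probability_setC ?mu1 ?subee//; exact: measurable_itv22.
Qed.

Lemma null_setI22 (B : set (borelR R)) : measurable B -> mu (D `&` B) = 0%E -> mu B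
  = 0%E.
Proof.
move=> mB DB0; have mD := @measurable_itv22 R.
have BE : B = (D `&` B) `|` (~` D `&` B).
  by rewrite -setIUl setUv setTI.
rewrite BE; apply/eqP; rewrite -measure_le0.
have mDB : measurable (D `&` B) by exact: measurableI.
have mCB : measurable (~` D `&` B) by apply: measurableI => //; exact: measurableC.
apply: le_trans (measureU2 _ mDB mCB) _.
have CB0 : mu (~` D `&` B) = 0%E.
  by apply: (subset_measure0 _ _ _ mu_setC22) => //; exact: measurableC.
by move: DB0 CB0 => /= -> ->; rewrite adde0.
Qed.

Let mLe x : measurable [set t : borelR R | t <= x].
Proof.
by rewrite (_ : [set t | _] = `]-oo, x]%classic)//; apply/seteqP; split => t /=;
  rewrite in_itv.
Qed.

Lemma angle_potential0B p q : p <= q ->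
  V q 0 - V p 0 = pi * fine (mu (D `&` `]p, q]%classic)).
Proof.
move=> pq; rewrite !angle_potential0 -mulrBr; congr (_ * _).
have mD := @measurable_itv22 R.
have mpq : measurable (`]p, q]%classic : set (borelR R)) by exact: measurable_itv.
have -> : D `&` [set t : borelR R | t <= q] =
    (D `&` [set t : borelR R | t <= p]) `|` (D `&` `]p, q]%classic).
  apply/seteqP; split => t /=; rewrite in_itv/=.
    by move=> [Dt tq]; have [tp|tp] := leP t p; [left|right].
  by move=> [[Dt tp]|[Dt /andP[_ tq]]]; split => //; exact: le_trans tp pq.
rewrite measureU; [|exact: measurableI|exact: measurableI|].
  rewrite fineD; [by rewrite addrAC subrr add0r|..];
    by apply: fin_num_measure; exact: measurableI.
apply/seteqP; split => // t [[_ /= tp] [_ /=]]; rewrite in_itv/= ltNge.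
by rewrite tp.
Qed.

Lemma angle_potential0_eq p q : p < q -> V p 0 = V q 0 -> mu `[p, q]%classic = 0%E.
Proof.
move=> pq Vpq; have mD := @measurable_itv22 R.
have mpq : measurable (`]p, q]%classic : set (borelR R)) by exact: measurable_itv.
have /eqP := angle_potential0B (ltW pq).
rewrite Vpq subrr eq_sym mulf_eq0 gt_eqF ?pi_gt0//= => /eqP h.
have : mu (D `&` `]p, q]%classic) = 0%E.
  rewrite -[LHS]fineK; last by apply: fin_num_measure; exact: measurableI.
  by rewrite h.
move=> /(null_setI22 mpq) h0.
have -> : (`[p, q]%classic : set (borelR R)) = [set p] `|` `]p, q]%classic.
  by rewrite (@setU1itv _ _ (BRight q) p false)// bnd_simp ltW.
apply/eqP; rewrite -measure_le0.
apply: le_trans (measureU2 _ (measurable_pt p) mpq) _.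
by have := mu0 p; move: h0 => /= -> ->; rewrite adde0.
Qed.

Lemma angle_potential0_null p q (B : set (borelR R)) : p <= q -> measurable B ->
  `]p, q]%classic `<=` B -> mu B = 0%E -> V p 0 = V q 0.
Proof.
move=> pq mB sB B0; have mD := @measurable_itv22 R.
apply/eqP; rewrite eq_sym -subr_eq0 angle_potential0B//.
have mpq : measurable (`]p, q]%classic : set (borelR R)) by exact: measurable_itv.
rewrite (subset_measure0 _ _ _ B0) ?mulr0//; first exact: measurableI.
by move=> t [_ /sB].
Qed.

Lemma angle_potentialN2 : V (-2) 0 = 0.
Proof.
rewrite angle_potential0 (_ : _ `&` _ = [set (-2 : R)]).
  by have /= -> := mu0 (-2); rewrite mulr0.
apply/seteqP; split => [t [/itv22P/andP[h1 h2] /= h3]|t ->];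
  first by apply/le_anti; rewrite h1 h3.
by split; rewrite /itv22/= ?in_itv/= lexx//; lra.
Qed.

Lemma angle_potential2 : V 2 0 = pi.
Proof.
rewrite angle_potential0 (_ : _ `&` _ = D).
  by have /= -> := mu1; rewrite mulr1.
by apply/setIidPl => t /itv22P/andP[].
Qed.

Lemma angle_potential0_distribution x : x <= 2 ->
  V x 0 = pi * distribution_function mu x.
Proof.
move=> x2; rewrite angle_potential0 /distribution_function.
congr (_ * fine (mu _)); apply/seteqP; split => [t [/itv22P/andP[h1 h2] /= h3]|t].
  by rewrite /= in_itv/= h1 h3.
by rewrite /= !in_itv/= => /andP[h1 h2]; split => //;
  rewrite /itv22/= in_itv/= h1 (le_trans h2).
Qed.

Lemma continuous_angle_potential0 x : {for x, continuous (V ^~ 0)}.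
Proof.
apply/cvgrPdist_lt => e e0.
have [r r0 rH] := @small_ball x (e / pi) (divr_gt0 e0 (pi_gt0 R)).
near=> z.
have zr : `|x - z| <= r.
  by near: z; exists r => //= z; rewrite /ball_/=; exact: ltW.
have mD := @measurable_itv22 R.
have key p q : p <= q -> x - r <= p -> q <= x + r -> `|V p 0 - V q 0| < e.
  move=> pq hp hq; rewrite distrC angle_potential0B//.
  rewrite ger0_norm; last by rewrite mulr_ge0 ?pi_ge0// fine_ge0.
  rewrite -ltr_pdivlMl ?pi_gt0// mulrC; apply: le_lt_trans rH.
  have mpq : measurable (`]p, q]%classic : set (borelR R)) by exact: measurable_itv.
  have mB : measurable (`[x - r,
    x + r]%classic : set (borelR R)) by exact: measurable_itv.
  apply: fine_le; rewrite ?fin_num_measure//; first exact: measurableI.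
  apply: le_measure; rewrite ?inE//; first exact: measurableI.
  move=> t [_] /=; rewrite !in_itv/= => /andP[h1 h2].
  by rewrite (le_trans hp (ltW h1)) (le_trans h2 hq).
move: zr; rewrite ler_norml => /andP[h1 h2].
have [xz|/ltW zx] := leP x z; first by apply: key => //; lra.
by rewrite distrC; apply: key => //; lra.
Unshelve. all: by end_near. Qed.

Lemma top_supp_closed : closed (top_supp mu).
Proof. by apply: closed_bigI => C []. Qed.

(** The complement is a union of open null sets; null intervals with rational ends cover it, and
    there are countably many of them. *)
Lemma mu_setC_top_supp : mu (~` top_supp mu) = 0%E.
Proof.
pose J (ab : rat * rat) : set (borelR R) := `]ratr ab.1, ratr ab.2[%classic.
pose F (n : nat) : set (borelR R) :=
  if unpickle n is Some ab then (if `[< mu (J ab) = 0%E >] then J ab else set0)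
    else set0.
have mJ ab : measurable (J ab) by exact: measurable_itv.
have mF n : measurable (F n).
  by rewrite /F; case: unpickle => // ab; case: ifP.
have F0 n : mu.-negligible (F n).
  apply/negligibleP => //; rewrite /F; case: unpickle => [ab|]; last exact: measure0.
  by case: ifPn => [/asboolP//|_]; exact: measure0.
have mE : measurable (~` top_supp mu : set (borelR R)).
  apply: measurableC; apply: closed_measurable; exact: top_supp_closed.
apply/negligibleP => //.
apply: negligibleS (negligible_bigcup F0).
move=> x /existsNP[C /not_implyP[[cC C0] Cx]].
have oC : open (~` C) by exact: closed_openC.
have /nbhs_ballP[e /= e0 eC] : nbhs x (~` C) by exact: open_nbhs_nbhs.
have /rat_in_itvoo[a] : x - e < x by rewrite ltrBlDr ltrDl.
have /rat_in_itvoo[b] : x < x + e by rewrite ltrDl.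
rewrite !in_itv/= => /andP[b1 b2] /andP[a1 a2].
suff Jab : mu (J (a, b)) = 0%E.
  have [n Fn] : exists n, F n x; last by exists n.
  by exists (pickle (a, b)); rewrite /F pickleK ifT;
    [rewrite /J/= in_itv/= a2 b1|exact/asboolP].
apply: (subset_measure0 _ _ _ C0) => //.
  by apply: measurableC; exact: closed_measurable.
move=> t; rewrite /J/= in_itv/= => /andP[ta tb]; apply: eC.
rewrite /ball/= ltr_norml; apply/andP; split.
  by rewrite ltrBrDl ltrBlDr (lt_trans tb).
by rewrite ltrBlDr -ltrBlDl (lt_trans a1).
Qed.

(** A small ball around a point of the gap is connected, hence inside the component, and two of its
    points serve. *)
Lemma gap_label_pair a : gap_label mu (a / pi) ->
  exists p q : R, [/\ -2 <= p, p < q, q <= 2, V p 0 = a & V q 0 = a].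
Proof.
move=> [I [x Gx ->] kI].
set G := _ `\` _ in Gx kI.
have oG : open G.
  apply: openI; first exact: interval_open.
  by apply: closed_openC; exact: top_supp_closed.
have /nbhs_ballP[e /= e0 eG] : nbhs x G by exact: open_nbhs_nbhs.
have IG t : x - e < t < x + e -> V t 0 = a.
  move=> xt.
  have Gt : G t by apply: eG; rewrite /ball/= ltr_norml; apply/andP; split; lra.
  have t2 : t <= 2 by move: Gt => [] /=; rewrite in_itv/= => /andP[_ /ltW].
  rewrite angle_potential0_distribution// kI;
    first by rewrite mulrC divfK// gt_eqF ?pi_gt0.
  exists (`]x - e, x + e[%classic); last by rewrite /= in_itv/=.
  split.
  - by rewrite /= in_itv/= ltrBlDr ltrDl e0.
  - by move=> z; rewrite /= in_itv/= => h; apply: eG; rewrite /ball/= ltr_norml;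
    apply/andP; split; lra.
  - by apply/connected_intervalP; exact: interval_is_interval.
have G22 t : x - e < t < x + e -> -2 <= t <= 2.
  move=> xt; have [] : G t.
    by apply: eG; rewrite /ball/= ltr_norml; apply/andP; split; lra.
  by rewrite /= in_itv/= => /andP[/ltW -> /ltW ->].
have xe1 : x - e < x - e / 2 < x + e by apply/andP; split; lra.
have xe2 : x - e < x < x + e by apply/andP; split; lra.
exists (x - e / 2), x; split; [|by lra| |exact: IG|exact: IG].
- by have /andP[] := G22 _ xe1.
- by have /andP[] := G22 _ xe2.
Qed.

(** []p, q[] misses the support, so its midpoint lies in a gap. That gap may reach beyond [[p, q]],
    but [V] is constant on all of it because the complement of the support is null. *)
Lemma pair_gap_label a p q : -2 <= p -> p < q -> q <= 2 -> V p 0 = a -> V q 0 = a ->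
  gap_label mu (a / pi).
Proof.
move=> p2 pq q2 Vp Vq.
have pq0 := angle_potential0_eq pq (etrans Vp (esym Vq)).
have sE : `]p, q[%classic `<=` ~` top_supp mu.
  move=> t tpq; apply/existsNP; exists (~` `]p, q[%classic).
  apply/not_implyP; split; last by apply.
  split; first by apply: open_closedC; exact: interval_open.
  rewrite setCK; apply: (subset_measure0 _ _ _ pq0); [exact: measurable_itv..|].
  by move=> z /=; rewrite !in_itv/= => /andP[/ltW -> /ltW ->].
pose m := (p + q) / 2.
have pm : p < m by rewrite /m; lra.
have mq : m < q by rewrite /m; lra.
have Gm : (`]-2, 2[%classic `\` top_supp mu) m.
  split; last by apply: sE; rewrite /= in_itv/= pm mq.
  by rewrite /= in_itv/=; apply/andP; split; lra.
have mE : measurable (~` top_supp mu : set (borelR R)).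
  apply: measurableC; apply: closed_measurable; exact: top_supp_closed.
have Vm : V m 0 = a.
  apply/le_anti/andP; split; [rewrite -Vq|rewrite -Vp];
    by apply: angle_potential_le => //; exact: ltW.
exists (connected_component (`]-2, 2[%classic `\` top_supp mu) m); first by exists m.
move=> t It.
have Gt := connected_component_sub It.
have t2 : t <= 2 by move: Gt => [] /=; rewrite in_itv/= => /andP[_ /ltW].
suff Vt : V t 0 = a.
  by rewrite -Vt angle_potential0_distribution// mulrAC divff ?mul1r// gt_eqF ?pi_gt0.
have Im := connected_component_refl Gm.
have /connected_intervalP Iint := @component_connected _ (`]-2,
  2[%classic `\` top_supp mu) m.
have seg x y : x <= y -> connected_component (`]-2, 2[%classic `\` top_supp mu) m x ->
    connected_component (`]-2, 2[%classic `\` top_supp mu) m y -> V x 0 = V y 0.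
  move=> xy Ix Iy; apply: (angle_potential0_null xy mE _ mu_setC_top_supp).
  move=> z; rewrite /= in_itv/= => /andP[/ltW xz zy].
  have /connected_component_sub[] // : connected_component (`]-2,
    2[%classic `\` top_supp mu) m z.
  by apply: (Iint x y) => //; rewrite xz zy.
by rewrite -Vm; have [tm|/ltW mt] := leP t m; [exact: seg|apply/esym; exact: seg].
Qed.

End Potential.

(** * The conformal map *)

Section ComplexCoordinates.
Context {R : realType}.
Implicit Types (a b x y r t : R) (z w : R[i]).

Lemma normcE_norm z : `|z| = (Normc.normc z)%:C.
Proof. by rewrite normc_def; case: z. Qed.

Lemma normc_triangle z w :
  Normc.normc (z + w) <= Normc.normc z + Normc.normc w.
Proof. by have := ler_normD z w; rewrite !normcE_norm -rmorphD/= lecR. Qed.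

Lemma normc_distC z w : Normc.normc (z - w) = Normc.normc (w - z).
Proof. by apply: (@complexI R); rewrite -!normcE_norm distrC. Qed.

Lemma unit_discE a b : unit_disc (a +i* b) <-> a ^+ 2 + b ^+ 2 < 1.
Proof.
rewrite /unit_disc/= normc_def/= ltcR.
have N0 : 0 <= a ^+ 2 + b ^+ 2 by rewrite addr_ge0 ?sqr_ge0.
by rewrite -[X in _ < X]sqrtr1 ltr_sqrt ?ltr01.
Qed.

(* The coordinates of [- zeta - zeta^-1] for [zeta = a + i b]. *)
Definition joukowski_re a b : R := - a * (1 + (a ^+ 2 + b ^+ 2)^-1).
Definition joukowski_im a b : R := b * ((a ^+ 2 + b ^+ 2)^-1 - 1).

Lemma joukowskiE a b :
  - (a +i* b) - (a +i* b)^-1 = joukowski_re a b +i* joukowski_im a b :> R[i].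
Proof.
have -> : (a +i* b)^-1 = (a / (a ^+ 2 + b ^+ 2)) -i* (b / (a ^+ 2 + b ^+ 2)) :>
  R[i] by [].
by simpc; rewrite /joukowski_re /joukowski_im; congr (_ +i* _); ring.
Qed.

(** [z1] and [z2] are the roots of [z^2 + c z + 1]; their product is 1, so one of them has modulus
    at most 1. As [y > 0], this modulus is not 1 and the imaginary part of the root is positive. *)
Lemma joukowski_surj x y : 0 < y -> exists a b, [/\ a ^+ 2 + b ^+ 2 < 1, 0 < b,
  joukowski_re a b = x & joukowski_im a b = y].
Proof.
move=> y0; pose c : R[i] := x +i* y; pose s := sqrtc (c ^+ 2 - 4%:R).
have s2 : s ^+ 2 = c ^+ 2 - 4%:R by exact: sqr_sqrtc.
pose z1 := (- c + s) / 2%:R; pose z2 := (- c - s) / 2%:R.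
have z12 : z1 * z2 = 1.
  rewrite /z1 /z2 mulf_div [(- c + s) * _]mulrC -subr_sqr sqrrN s2 opprB addrC subrK.
  by rewrite -natrM divff// pnatr_eq0.
have sum12 : - z1 - z2 = c by rewrite /z1 /z2; field.
have zc z z' : z * z' = 1 -> - z - z' = c -> - z - z^-1 = c.
  move=> zz' <-; congr (_ - _).
  have z0 : z != 0 by apply: contra_eq_neq zz' => ->; rewrite mul0r eq_sym oner_neq0.
  by apply: (mulfI z0); rewrite divff.
have main z : - z - z^-1 = c -> Normc.normc z <= 1 -> exists a b,
  [/\ a ^+ 2 + b ^+ 2 < 1, 0 < b,
    joukowski_re a b = x & joukowski_im a b = y].
  case: z => a b; rewrite joukowskiE => -[jr ji] /= N1.
  have {}N1 : a ^+ 2 + b ^+ 2 <= 1.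
    rewrite -(@sqr_sqrtr _ (a ^+ 2 + b ^+ 2)) ?addr_ge0 ?sqr_ge0//.
    by rewrite expr_le1 ?sqrtr_ge0.
  exists a, b; split => //.
    rewrite lt_neqAle N1 andbT; apply/eqP => NE.
    by move: ji y0; rewrite /joukowski_im NE invr1 subrr mulr0 => <-; rewrite ltxx.
  have [/eqP|N0] := eqVneq (a ^+ 2 + b ^+ 2) 0.
    rewrite paddr_eq0 ?sqr_ge0// !sqrf_eq0 => /andP[_ /eqP b0].
    by move: ji y0; rewrite /joukowski_im b0 mul0r => <-; rewrite ltxx.
  rewrite ltNge; apply/negP => b0.
  move: y0; rewrite -ji ltNge /joukowski_im => /negP; apply.
  rewrite mulr_le0_ge0// subr_ge0 invf_ge1// lt_def N0 addr_ge0 ?sqr_ge0//.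
have [h|h] := leP (Normc.normc z1) 1; first by apply: (main z1) => //;
  exact: (zc _ z2).
apply: (main z2); first by apply: (zc _ z1); rewrite 1?mulrC// addrC.
have : Normc.normc z1 * Normc.normc z2 = 1 by rewrite -Normc.normcM z12 Normc.normc1.
move=> h2; rewrite leNgt; apply/negP => h3.
by have := mulr_egt1 h h3; rewrite h2 ltxx.
Qed.

Lemma region_polar (h : R[i] -> R) r t : 0 < r ->
  region h ((r * cos t) +i* (r * sin t)) <-> r < 1 - h (expi t).
Proof.
move=> r0.
have E (r' t' : R) : r'%:C * expi t' = (r' * cos t') +i* (r' * sin t') :> R[i].
  by rewrite /expi; simpc.
split; last by move=> h1; exists r, t; rewrite ltW//=; split.
move=> [r' [t' [/andP[r'0 r'h]]]]; rewrite E => -[e1 e2].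
have rr' : r = r'.
  apply/eqP; rewrite -(eqrXn2 (n := 2))// ?(ltW r0)//; apply/eqP.
  have : (r * cos t) ^+ 2 + (r * sin t) ^+ 2 = (r' * cos t') ^+ 2 + (r' * sin t')
    ^+ 2.
    by rewrite e1 e2.
  by rewrite !exprMn -!mulrDr !cos2Dsin2 !mulr1.
rewrite -rr' in r'h e1 e2; rewrite (_ : expi t = expi t')//.
by rewrite /expi; congr (_ +i* _); apply: (mulfI (lt0r_neq0 r0)).
Qed.

Lemma holomorphic_continuous (F : R[i] -> R[i]) z (e : R) :
  holomorphic_on unit_disc F -> unit_disc z -> 0 < e ->
  exists2 d : R, 0 < d & forall w, Normc.normc (z - w) < d ->
    Normc.normc (F z - F w) < e.
Proof.
move=> /[apply] /derivable1_diffP /differentiable_continuous cF e0.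
have e0' : 0 < e%:C by rewrite ltcR.
have /cvgrPdist_lt/(_ _ e0')[d /= d0 dH] := cF.
(* Positive elements of [R[i]] are real. *)
have dE : d = (complex.Re d)%:C.
  by case: d d0 {dH} => d1 d2; rewrite ltcE/= => /andP[/eqP -> _].
exists (complex.Re d); first by move: d0; rewrite dE ltcR.
move=> w zw; have := dH w; rewrite /ball_/= dE => H.
have {}H : `|F z - F w| < e%:C by apply: H; rewrite normc_def ltcR; move: zw;
  case: (z - w).
by move: H; rewrite normc_def ltcR; case: (F z - F w).
Qed.

End ComplexCoordinates.

Section AssociatedMap.
Context {R : realType} (A : R) (dk : probability (measurableTypeR R) R).
Local Notation U := (log_potential dk).
Local Notation V := (angle_potential dk).

Lemma wfunE x y : 0 < y ->
  wfun A dk (x +i* y) = (ln A - U x y) +i* V x y.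
Proof.
move=> y0; rewrite /wfun.
have Eri (t : R) : (t%:C - (x +i* y))%C = (t - x) +i* (- y) :> R[i] by simpc.
have -> : \int[dk]_(t in itv22) complex.Re (cln_lower (t%:C - (x +i* y))) = U x y.
  apply: eq_Rintegral => t _; rewrite Eri /cln_lower/= sqrrN.
  exact: ln_sqrt_logmod.
have -> : \int[dk]_(t in itv22) complex.Im (cln_lower (t%:C - (x +i* y))) = - V x y.
  transitivity (-1 * V x y); last by rewrite mulN1r.
  rewrite /V /angle_potential -(RintegralZl (-1) (@measurable_itv22 R));
    last exact: integrable_angle.
  apply: eq_Rintegral => t _; rewrite Eri /cln_lower/= sqrrN acos_angle// mulN1r.
  by [].
by simpc.
Qed.

Variable F : R[i] -> R[i].
Hypothesis FE : conformal_extension A dk F.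

Lemma conformal_extension_upper a b : a ^+ 2 + b ^+ 2 < 1 -> 0 < b ->
  F (a +i* b) =
    (expR (ln A - U (joukowski_re a b) (joukowski_im a b)) *
       cos (V (joukowski_re a b) (joukowski_im a b))) +i*
    (expR (ln A - U (joukowski_re a b) (joukowski_im a b)) *
       sin (V (joukowski_re a b) (joukowski_im a b))).
Proof.
move=> N1 b0; have [_ FU _] := FE.
have N0 : 0 < a ^+ 2 + b ^+ 2 by rewrite ltr_wpDl ?sqr_ge0 ?exprn_gt0.
have Y0 : 0 < joukowski_im a b by rewrite mulr_gt0// subr_gt0 invf_gt1.
rewrite FU; last by split => //; exact/unit_discE.
by rewrite joukowskiE wfunE// /cexp /expi/=; simpc.
Qed.

Lemma conformal_extension_conj a b : a ^+ 2 + b ^+ 2 < 1 ->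
  F (a -i* b) = conjc (F (a +i* b)).
Proof. by move=> /unit_discE ab; have [_ _ <-] := FE. Qed.

Lemma conformal_extension_real a : a ^+ 2 < 1 -> complex.Im (F a%:C) = 0.
Proof.
move=> a1; have := @conformal_extension_conj a 0.
rewrite expr0n/= addr0 oppr0 => /(_ a1); rewrite -[a +i* 0]/(a%:C).
by case: (F a%:C) => x y /= -[yE]; apply/eqP; rewrite -[_ == _]/(y == 0); lra.
Qed.

Lemma conformal_extension_continuous a b e : a ^+ 2 + b ^+ 2 < 1 -> 0 < e ->
  exists2 d, 0 < d & forall a' b', `|a - a'| < d -> `|b - b'| < d ->
    Normc.normc (F (a +i* b) - F (a' +i* b')) < e.
Proof.
move=> /unit_discE ab e0; have [hF _ _] := FE.
have [d d0 dH] := holomorphic_continuous hF ab e0.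
exists (d / 2); first by rewrite divr_gt0.
move=> a' b' aa' bb'; apply: dH; rewrite -[_ - _]/((a - a') +i* (b - b'))/=.
rewrite -[ltRHS](ger0_norm (ltW d0)) -sqrtr_sqr ltr_sqrt ?exprn_gt0//.
rewrite -(real_normK (num_real (a - a'))) -(real_normK (num_real (b - b'))).
have := normr_ge0 (a - a'); have := normr_ge0 (b - b'); nra.
Qed.

End AssociatedMap.

(** * Slit heights as boundary values *)

Section SlitHeights.
Context {R : realType} (h : R[i] -> R) (A : R) (dk : probability (measurableTypeR
  R) R).
Variable F : R[i] -> R[i].
Hypothesis Adk : pair_class A dk.
Hypothesis FE : conformal_extension A dk F.
Hypothesis Oh : region h = F @` unit_disc.
Local Notation U := (log_potential dk).
Local Notation V := (angle_potential dk).
Local Notation u x y := (ln A - U x y).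
Let mu1 := pair_class_mass1 Adk.
Let mu0 := pair_class_atomless Adk.
Let intlog := pair_class_integrable_log Adk.

(** Every point of the upper half plane comes from the half disc under [zeta |-> - zeta - 1 / zeta],
    so [e^(u + i v)] lies in the region. *)
Lemma slit_above x y : 0 < y -> expR (u x y) < 1 - h (expi (V x y)).
Proof.
move=> y0; have [a [b [N1 b0 <- <-]]] := joukowski_surj x y0.
apply/region_polar; rewrite ?expR_gt0// Oh; exists (a +i* b); first exact/unit_discE.
by rewrite (conformal_extension_upper FE N1 b0).
Qed.

Lemma joukowski_im_gt0 (a b : R) : a ^+ 2 + b ^+ 2 < 1 -> 0 < b -> 0 < joukowski_im
  a b.
Proof.
move=> N1 b0; have N0 : 0 < a ^+ 2 + b ^+ 2 by rewrite ltr_wpDl ?sqr_ge0 ?exprn_gt0.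
by rewrite mulr_gt0// subr_gt0 invf_gt1.
Qed.

Lemma angle_eq (v a : R) : 0 < v < pi -> 0 <= a <= pi -> cos v = cos a -> v = a.
Proof.
move=> /andP[v0 v1] a01 /cos_inj; apply; rewrite ?in_itv//=.
by rewrite !ltW.
Qed.

Lemma sin_cos_pm1 (a : R) : 0 <= a <= pi -> sin a = 0 ->
  (a = 0 /\ cos a = 1) \/ (a = pi /\ cos a = -1).
Proof.
move=> /andP[a0 api] sa.
have [a0'|a0'] := eqVneq a 0; first by left; rewrite a0' cos0.
have [a1'|a1'] := eqVneq a pi; first by right; rewrite a1' cospi.
have : 0 < sin a by apply: sin_gt0_pi; rewrite !lt_def a0' a0 [_ == a]eq_sym a1' api.
by rewrite sa ltxx.
Qed.

Lemma normc_polar (r t : R) : 0 <= r -> Normc.normc ((r * cos t) +i* (r * sin t)) = r.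
Proof. by move=> r0; rewrite /= !exprMn -mulrDr cos2Dsin2 mulr1 sqrtr_sqr
  ger0_norm. Qed.

(* Points of the half disc approaching a real point tangentially enough are sent
   beyond the end [-2 t] of the spectrum, where the sign of [cos v] is known. *)
Lemma joukowski_re_far (t a b : R) : t = 1 \/ t = -1 -> 0 < t * a -> t * a < 1 -> 0
  < b ->
  2 * b ^+ 2 < t * a * (1 - t * a) ^+ 2 ->
  a ^+ 2 + b ^+ 2 < 1 /\ t * joukowski_re a b < - 2.
Proof.
move=> t1 ta0 ta1 b0 hb.
set c := t * a in ta0 ta1 hb.
have a2 : a ^+ 2 = c ^+ 2 by rewrite /c; case: t1 => ->; ring.
have c2 : 0 < c * (1 - c) by nra.
have N1 : c ^+ 2 + b ^+ 2 < 1 by nra.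
rewrite /joukowski_re a2 mulrA mulrN -/c; split => //.
have N0 : 0 < c ^+ 2 + b ^+ 2 by nra.
have key : 2 * (c ^+ 2 + b ^+ 2) < c * (c ^+ 2 + b ^+ 2) + c by nra.
rewrite mulNr ltrN2 -(ltr_pM2r N0).
by have -> : c * (1 + (c ^+ 2 + b ^+ 2)^-1) * (c ^+ 2 + b ^+ 2) = c * (c ^+ 2 + b
  ^+ 2) + c
  by field; rewrite gt_eqF.
Qed.

(** The point is moved outwards by [e], which keeps it in the disc and makes [t * a'] positive even
    when [a = 0]; [b] is then taken so small that [2 b^2 < K]. *)
Lemma near_real (a t d : R) : t = 1 \/ t = -1 -> 0 <= t * a -> t * a < 1 -> 0 < d ->
  exists a' b, [/\ 0 < b, a' ^+ 2 + b ^+ 2 < 1, `|a - a'| < d, `|0 - b| < d &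
    t * joukowski_re a' b < - 2].
Proof.
move=> t1 ta0 ta1 d0.
pose e := Num.min (d / 2) ((1 - t * a) / 2).
have e0 : 0 < e by rewrite lt_min !divr_gt0// subr_gt0.
have ed : e <= d / 2 by rewrite ge_min lexx.
have e1 : e <= (1 - t * a) / 2 by rewrite ge_min lexx orbT.
have tt : t * t = 1 by case: t1 => ->; ring.
pose a' := a + t * e.
have ta' : t * a' = t * a + e by rewrite /a' mulrDr mulrA tt mul1r.
pose K := t * a' * (1 - t * a') ^+ 2.
have K0 : 0 < K by rewrite /K ta' mulr_gt0 ?exprn_gt0//; lra.
pose b := Num.min (d / 2) (Num.min (K / 4) 1).
have b0 : 0 < b by rewrite !lt_min ltr01 !divr_gt0.
have bd : b <= d / 2 by rewrite ge_min lexx.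
have bK : b <= K / 4 by rewrite !ge_min lexx orbT.
have b1 : b <= 1 by rewrite !ge_min lexx !orbT.
have ta'0 : 0 < t * a' by rewrite ta'; lra.
have ta'1 : t * a' < 1 by rewrite ta'; lra.
have hb : 2 * b ^+ 2 < t * a' * (1 - t * a') ^+ 2 by rewrite -/K; nra.
have [N1 J] := joukowski_re_far t1 ta'0 ta'1 b0 hb.
exists a', b; split => //.
- rewrite /a' opprD addNKr normrN normrM.
  have -> : `|t| = 1 by case: (t1) => ->; rewrite ?normrN normr1.
  by rewrite mul1r gtr0_norm//; lra.
- by rewrite sub0r normrN gtr0_norm//; lra.
Qed.

Lemma Re_normc_le (z : R[i]) : `|complex.Re z| <= Normc.normc z.
Proof.
by case: z => a b /=; rewrite -sqrtr_sqr ler_wsqrtr// lerDl sqr_ge0.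
Qed.

Lemma conformal_extension_near_real (a t : R) (e : R) :
  t = 1 \/ t = -1 -> 0 <= t * a -> t * a < 1 -> 0 < e ->
  exists x y : R, [/\ 0 < y, t * x < - 2 &
    Normc.normc (F a%:C - ((expR (u x y) * cos (V x y)) +i* (expR (u x y) * sin (V
      x y)))) < e].
Proof.
move=> t1 ta0 ta1 e0.
have a1 : a ^+ 2 + 0 ^+ 2 < 1.
  rewrite expr0n/= addr0; case: t1 ta0 ta1 => ->; rewrite ?mul1r ?mulN1r => ? ?; nra.
have [d d0 dH] := conformal_extension_continuous FE a1 e0.
have [a' [b [b0 N1 aa' bb' J]]] := near_real t1 ta0 ta1 d0.
exists (joukowski_re a' b), (joukowski_im a' b); split => //.
  exact: joukowski_im_gt0.
by have := dH _ _ aa' bb'; rewrite (conformal_extension_upper FE N1 b0).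
Qed.

Lemma cos_angle_potential_ge0 (t x y : R) : t = 1 \/ t = -1 -> 0 < y -> t * x < - 2 ->
  0 <= t * cos (V x y).
Proof.
move=> t1 y0 tx.
have v0 := angle_potential_gt0 mu1 x (lt0r_neq0 y0).
have v1 := angle_potential_lt_pi mu1 x (lt0r_neq0 y0).
case: t1 tx => ->; rewrite ?mul1r ?mulN1r => tx.
  apply: cos_ge0_pihalf; rewrite (angle_potential_le_pihalf mu1) ?andbT; last by [].
  by have := pi_gt0 R; lra.
have x2 : 2 < x by lra.
have v2 := angle_potential_ge_pihalf mu1 y x2.
rewrite -[V x y](subrK (pi / 2)) cosDpihalf opprK sin_ge0_pi// subr_ge0 v2/=.
by have := pi_gt0 R; lra.
Qed.


(** The equation forces [V X Y = V x 0], so only the height term of [potential_mono] is left, giving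
    [U X Y >= U x 0]. *)
Lemma boundary_value_le x X Y r a : 0 < Y -> 0 < r -> 0 <= a <= pi -> V x 0 = a ->
  (expR (u X Y) * cos (V X Y)) +i* (expR (u X Y) * sin (V X Y)) = (r * cos a) +i*
    (r * sin a) ->
  r <= expR (u x 0).
Proof.
move=> Y0 r0 a01 Vx E.
have rE : r = expR (u X Y).
  by rewrite -(normc_polar a (ltW r0)) -E normc_polar// expR_ge0.
have Va : V X Y = a.
  apply: angle_eq => //.
    by rewrite (angle_potential_gt0 mu1) ?(angle_potential_lt_pi mu1)// gt_eqF.
  by move: E => [+ _]; rewrite rE => /mulfI; apply; rewrite gt_eqF// expR_gt0.
have := potential_mono mu0 intlog X x (ltW Y0) (lexx 0).
rewrite Va Vx subrr mul0r add0r subr0 pmulr_lge0// subr_ge0 => h1.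
by rewrite rE ler_expR lerB.
Qed.

(** With [V x 0] equal to 0 or [pi] and [X] beyond the corresponding end, the horizontal term of
    [potential_mono] is nonpositive, so the vertical one is nonnegative. *)
Lemma side_value_le (t x X Y : R) : t = 1 \/ t = -1 -> -2 <= x <= 2 -> 0 < Y ->
  V x 0 = (if t == 1 then 0 else pi) -> t * X < - 2 -> U x 0 <= U X Y.
Proof.
move=> t1 /andP[x1 x2] Y0 Vx tX.
have := potential_mono mu0 intlog X x (ltW Y0) (lexx 0).
have v0 := angle_potential_gt0 mu1 X (lt0r_neq0 Y0).
have v1 := angle_potential_lt_pi mu1 X (lt0r_neq0 Y0).
rewrite subr0 Vx => H.
rewrite -subr_ge0 -(pmulr_lge0 _ Y0); apply: le_trans H _.
rewrite gerDr; case: t1 tX => ->; rewrite ?eqxx ?mul1r ?mulN1r => tX; first by nra.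
have -> : (-1 == 1 :> R) = false by apply/lt_eqF; lra.
nra.
Qed.

(** A point of the region at angle [a] and radius [r > e^(u x 0)] would have a preimage in the lower
    half disc, where imaginary parts are negative, in the upper one, excluded by
    [boundary_value_le], or on the real diameter. In the last case [a] is 0 or [pi], and values from
    the upper half disc approximate. *)
Lemma slit_height_le x a : -2 <= x <= 2 -> 0 <= a <= pi -> V x 0 = a ->
  1 - h (expi a) <= expR (u x 0).
Proof.
move=> x22 a01 Vx; rewrite leNgt; apply/negP => lth.
pose r := (expR (u x 0) + (1 - h (expi a))) / 2.
have ur : expR (u x 0) < r by rewrite /r; lra.
have rh : r < 1 - h (expi a) by rewrite /r; lra.
have r0 : 0 < r by rewrite (lt_trans _ ur)// expR_gt0.
have : region h ((r * cos a) +i* (r * sin a)) by exact/region_polar.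
rewrite Oh => -[[c d] /unit_discE cd].
have [d0|d0|d0] := ltgtP d 0.
- have d'0 : 0 < - d by rewrite oppr_gt0.
  have cd' : c ^+ 2 + (- d) ^+ 2 < 1 by rewrite sqrrN.
  have := conformal_extension_conj FE cd'.
  rewrite opprK (conformal_extension_upper FE cd' d'0) => -> [_ E].
  have Y0 := joukowski_im_gt0 cd' d'0.
  have sV : 0 < sin (V (joukowski_re c (- d)) (joukowski_im c (- d))).
    by rewrite sin_gt0_pi// (angle_potential_gt0 mu1) ?(angle_potential_lt_pi
      mu1)// gt_eqF.
  have : 0 <= r * sin a by rewrite mulr_ge0 ?(ltW r0)// sin_ge0_pi.
  by rewrite -E oppr_ge0 leNgt mulr_gt0// expR_gt0.
- rewrite (conformal_extension_upper FE cd d0) => E.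
  have := boundary_value_le (joukowski_im_gt0 cd d0) r0 a01 Vx E.
  by rewrite leNgt ur.
rewrite d0 -[c +i* 0]/(c%:C) => E.
have c1 : c ^+ 2 < 1 by move: cd; rewrite d0 expr0n/= addr0.
have sa : sin a = 0.
  have := conformal_extension_real FE c1; rewrite E/= => /eqP.
  by rewrite mulf_eq0 gt_eqF//= => /eqP.
have [t [t1 ca Vt]] : exists t : R, [/\ t = 1 \/ t = -1,
  cos a = t & V x 0 = (if t == 1 then 0 else pi)].
  have [[a0 ca]|[api ca]] := sin_cos_pm1 a01 sa.
    by exists 1; split; [left| |rewrite eqxx Vx].
  exists (-1); split; [by right|by []|].
  have -> : (-1 == 1 :> R) = false by apply/lt_eqF; lra.
  by rewrite Vx.
rewrite sa ca mulr0 in E.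
have tt : t * t = 1 by case: (t1) => ->; ring.
have nt1 : - t = 1 \/ - t = -1 by case: (t1) => ->; [right|left]; rewrite ?opprK.
have tc1 : t * c < 1 by case: (t1) => ->; nra.
have ntc1 : - t * c < 1 by case: (t1) => ->; nra.
(* If [t * c < 0], some approximating value has real part 0 or of the sign of [- t], at distance at
   least [r] from [t r]. Otherwise the approximating value has modulus at most [e^(u x 0)]. *)
have [tc0|tc0] := leP 0 (t * c); last first.
  have ntc0 : 0 <= - t * c by rewrite mulNr oppr_ge0 ltW.
  have [X [Y [Y0 tX near]]] := conformal_extension_near_real nt1 ntc0 ntc1 r0.
  have cV := cos_angle_potential_ge0 nt1 Y0 tX.
  have := le_lt_trans (Re_normc_le _) near; rewrite E/= ltr_norml => /andP[n1 n2].
  have e0 := expR_gt0 (u X Y).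
  have : 0 <= expR (u X Y) * (- t * cos (V X Y)) by rewrite mulr_ge0// ltW.
  rewrite mulrCA mulNr oppr_ge0; move: (expR _ * _) n1 n2 => p n1 n2 n3.
  clear -t1 r0 n1 n2 n3.
  by case: t1 => tE; move: n1 n2 n3; rewrite tE; lra.
have e0 : 0 < r - expR (u x 0) by rewrite subr_gt0.
have [X [Y [Y0 tX near]]] := conformal_extension_near_real t1 tc0 tc1 e0.
have UU := side_value_le t1 x22 Y0 Vt tX.
have nF : Normc.normc (F c%:C) = r.
  by rewrite E/= expr0n/= addr0 sqrtr_sqr normrM gtr0_norm//; case: (t1) => ->;
    rewrite ?normrN normr1 mulr1.
have := normc_triangle (F c%:C - ((expR (u X Y) * cos (V X Y)) +i* (expR (u X Y) *
  sin (V X Y))))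
  ((expR (u X Y) * cos (V X Y)) +i* (expR (u X Y) * sin (V X Y))).
rewrite subrK nF normc_polar ?expR_ge0// => n1.
have : expR (u X Y) <= expR (u x 0) by rewrite ler_expR lerB.
move: near n1; set N := Normc.normc _; move: N (expR _) (expR _) => N e1 e2.
by clear; lra.
Qed.

(** [U] increases with the height, so for [Y <= k] it is at most [U X k], which is continuous in [X]
    because [k > 0], and [U x0 k] is close to [U x0 0] for small [k]. *)
Lemma log_potential_usc x0 e : 0 < e -> exists k d : R, [/\ 0 < k, 0 < d &
  forall X Y, 0 <= Y -> Y <= k -> `|X - x0| < d -> U X Y <= U x0 0 + e].
Proof.
move=> e0; have e20 : 0 < e / 2 by rewrite divr_gt0.
have /cvgrPdist_lt/(_ _ e20)[k0 /= k00 k0H] := @continuous_log_y _ _ mu0 intlog x0 0.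
pose k := k0 / 2; have k_gt0 : 0 < k by rewrite divr_gt0.
have /cvgrPdist_lt/(_ _ e20)[d /= d0 dH] := @continuous_log_x _ _ intlog k x0
  (lt0r_neq0 k_gt0).
exists k, d; split => // X Y Y0 Yk Xx.
have h1 := log_potential_le mu0 intlog X Y0 Yk.
have := k0H k; rewrite /ball_/= sub0r normrN gtr0_norm// => h2.
have {}h2 := h2 ltac:(rewrite /k; lra).
have := dH X; rewrite /ball_/= distrC => /(_ Xx) h3.
move: h2 h3; rewrite !ltr_norml => /andP[? ?] /andP[? ?]; lra.
Qed.

(** By uniqueness [V] at height 0 is below [a] at [x0 - c] and above it at [x0 + c]. This persists
    at a small height [y], where the intermediate value theorem gives a point of the level set near
    [x0]. *)
Lemma slit_height_ge_interior x0 a e : -2 < x0 < 2 -> V x0 0 = a -> 0 < e ->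
  (forall x, -2 <= x <= 2 -> V x 0 = a -> x = x0) ->
  expR (u x0 0 - e) <= 1 - h (expi a).
Proof.
move=> /andP[x1 x2] Vx0 e0 uniq.
have [k [d [k0 d0 kd]]] := log_potential_usc x0 e0.
pose c := Num.min (d / 2) (Num.min ((x0 + 2) / 2) ((2 - x0) / 2)).
have c0 : 0 < c by rewrite !lt_min !divr_gt0//; lra.
have cd : c <= d / 2 by rewrite ge_min lexx.
have cx1 : c <= (x0 + 2) / 2 by rewrite !ge_min lexx !orbT.
have cx2 : c <= (2 - x0) / 2 by rewrite !ge_min lexx !orbT.
have Vl : V (x0 - c) 0 < a.
  rewrite lt_neqAle -{2}Vx0 (angle_potential_le mu0 intlog) ?andbT//; last by lra.
  apply/eqP => /uniq h1; have : x0 - c = x0 by apply: h1; apply/andP; split; lra.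
  lra.
have Vr : a < V (x0 + c) 0.
  rewrite lt_neqAle -{2}Vx0 (angle_potential_le mu0 intlog) ?andbT//; last by lra.
  apply/eqP => /esym/uniq h1; have : x0 + c = x0 by apply: h1; apply/andP; split; lra.
  lra.
have cV x : V x y @[y --> 0^'+] --> V x 0.
  by apply: cvg_at_right_filter; exact: continuous_angle_potential_y mu0 x 0.
near (0 : R)^'+ => y.
have y0 : 0 < y by near: y; exact: nbhs_right_gt.
have yk : y <= k by near: y; exact: nbhs_right_le.
have Vly : V (x0 - c) y < a by near: y; exact: (cvgr_lt _ (cV _)).
have Vry : a < V (x0 + c) y by near: y; exact: (cvgr_gt _ (cV _)).
have cc : {within `[x0 - c, x0 + c], continuous (V ^~ y)}.
  apply: continuous_subspaceT => z.
  exact: continuous_angle_potential_x (lt0r_neq0 y0).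
have lecc : x0 - c <= x0 + c by lra.
have [|X] := IVT lecc cc (v := a).
  have VV : V (x0 - c) y <= V (x0 + c) y by rewrite ltW// (lt_trans Vly).
  by rewrite (min_idPl VV) (max_idPr VV) !ltW.
rewrite in_itv/= => /andP[X1 X2] VX.
rewrite -VX; apply: ltW; apply: le_lt_trans (slit_above X y0).
rewrite ler_expR -addrA -opprD lerB//; apply: kd => //.
by rewrite ltr_norml; apply/andP; split; lra.
Unshelve. all: by end_near. Qed.

(** The values 0 and [pi] of [V] are not attained in the open half plane, so the level set is
    replaced by a real point [t c] of the disc, with [c] close to 1. Its image is controlled through
    [F (t c + i b)] for small [b]. *)
Lemma slit_height_ge_end t x0 a e : t = 1 \/ t = -1 -> t * x0 = - 2 ->
  cos a = t -> sin a = 0 -> 0 < e ->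
  expR (u x0 0 - e) <= 1 - h (expi a).
Proof.
move=> t1 tx0 ca sa e0.
have tt : t * t = 1 by case: (t1) => ->; ring.
have nt : `|t| = 1 by case: (t1) => ->; rewrite ?normrN normr1.
have [k [d [k0 d0 kd]]] := log_potential_usc x0 e0.
pose m := Num.min (1 / 2) (d / 2).
have m0 : 0 < m by rewrite lt_min !divr_gt0.
have m1 : m <= 1 / 2 by rewrite ge_min lexx.
have md : m <= d / 2 by rewrite ge_min lexx orbT.
pose c := 1 - m.
have tcE : t * (t * c) = c by rewrite mulrA tt mul1r.
set M := expR _.
have M0 : 0 < M by exact: expR_gt0.
have approx e1 : 0 < e1 -> exists w : R[i], [/\ Normc.normc (F (t * c)%:C - w) < e1,
    M <= Normc.normc w & 0 <= t * complex.Re w].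
  move=> e10.
  have c2 : (t * c) ^+ 2 + 0 ^+ 2 < 1.
    rewrite exprMn expr2 tt mul1r expr0n/= addr0 /c; nra.
  have [d1 d10 d1H] := conformal_extension_continuous FE c2 e10.
  pose K := c * (1 - c) ^+ 2.
  have K0 : 0 < K by rewrite mulr_gt0 ?exprn_gt0// /c; lra.
  pose b := Num.min (Num.min (d1 / 2) (k / 4)) (Num.min (K / 4) 1).
  have b0 : 0 < b by rewrite !lt_min ltr01 !divr_gt0.
  have bd : b <= d1 / 2 by rewrite !ge_min lexx.
  have bk : b <= k / 4 by rewrite !ge_min lexx orbT.
  have bK : b <= K / 4 by rewrite !ge_min lexx !orbT.
  have b1 : b <= 1 by rewrite !ge_min lexx !orbT.
  have [|||N1 J] := joukowski_re_far (a := t * c) t1 _ _ b0 _; rewrite ?tcE -/K;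
    [rewrite /c; lra|rewrite /c; lra|nra|].
  pose I := ((t * c) ^+ 2 + b ^+ 2)^-1.
  have c0 : 0 < c by rewrite /c; lra.
  have N4 : 1 / 4 <= (t * c) ^+ 2 + b ^+ 2.
    by rewrite exprMn [t ^+ 2]expr2 tt mul1r /c; nra.
  have N0 : 0 < (t * c) ^+ 2 + b ^+ 2 by lra.
  have I0 : 0 < I by rewrite invr_gt0.
  have IN : I * ((t * c) ^+ 2 + b ^+ 2) = 1 by rewrite mulVf// gt_eqF.
  have I4 : I <= 4 by nra.
  exists (F ((t * c) +i* b)); split.
  - by apply: d1H; rewrite ?subrr ?normr0// sub0r normrN gtr0_norm//; lra.
  - rewrite (conformal_extension_upper FE N1 b0) normc_polar ?expR_ge0//.
    rewrite ler_expR -addrA -opprD lerB//; apply: kd.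
    + exact/ltW/joukowski_im_gt0.
    + have : b * I <= b * 4 by rewrite ler_pM2l.
      rewrite /joukowski_im -/I; lra.
    + have -> : `|joukowski_re (t * c) b - x0| = - (t * joukowski_re (t * c) b) - 2.
        have -> : `|joukowski_re (t * c) b - x0| = `|t * (joukowski_re (t * c) b -
          x0)|.
          by rewrite normrM nt mul1r.
        by rewrite mulrBr tx0 ltr0_norm; [ring|lra].
      rewrite /joukowski_re -/I mulrA mulrN tcE.
      have : c * (c * I) <= 1.
        by rewrite mulrA -expr2 -IN mulrC ler_pM2l// exprMn [t ^+ 2]expr2 tt mul1r
          lerDl sqr_ge0.
      (* Since [m <= 1 / 2], [(1 - m) (1 + m + 2 m^2) = 1 + m^2 (1 - 2 m) >= 1]. Hence
         [c I <= 1 + m + 2 m^2], and the distance to [x0] is at most [2 m^2 <= m < d]. *)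
      have : 1 <= c * (1 + m + 2 * m ^+ 2) by rewrite /c; nra.
      move=> h1 h2; have : c * I <= 1 + m + 2 * m ^+ 2.
        by rewrite -(ler_pM2l c0) (le_trans h2).
      rewrite /c in c0 *; nra.
  - rewrite (conformal_extension_upper FE N1 b0)/= mulrCA.
    rewrite mulr_ge0 ?expR_ge0//; apply: cos_angle_potential_ge0 => //.
    exact: joukowski_im_gt0.
pose rho := t * complex.Re (F (t * c)%:C).
have imF : complex.Im (F (t * c)%:C) = 0.
  by apply: (conformal_extension_real FE); rewrite exprMn expr2 tt mul1r /c; nra.
have nF : Normc.normc (F (t * c)%:C) = `|rho|.
  rewrite /rho normrM nt mul1r; move: imF; case: (F _) => f1 f2 /= ->.
  by rewrite expr0n/= addr0 sqrtr_sqr.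
(* The approximants [w] have modulus at least [M] and [t * Re w >= 0]; the former excludes
   [0 <= rho < M], the latter [rho < 0]. *)
have Mrho : M <= rho.
  rewrite leNgt; apply/negP => ltM.
  have [rho0|rho0] := leP 0 rho.
    have [w [w1 w2 _]] := approx (M - rho) ltac:(lra).
    have := normc_triangle (w - F (t * c)%:C) (F (t * c)%:C).
    by rewrite subrK nF ger0_norm// normc_distC; lra.
  have [w [w1 _ w3]] := approx (- rho) ltac:(lra).
  have := le_lt_trans (Re_normc_le _) w1.
  have -> : complex.Re (F (t * c)%:C - w) = complex.Re (F (t * c)%:C) - complex.Re
    w by case: (F _) => ? ?; case: w {w1 w3}.
  rewrite -[`|_|](mul1r) -{1}nt -normrM mulrBr -/rho ltr_norml => /andP[h1 h2]; lra.
have rho0 : 0 < rho by exact: lt_le_trans Mrho.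
apply: (le_trans Mrho); apply/ltW/region_polar => //.
rewrite Oh; exists (t * c)%:C.
  apply/unit_discE; rewrite exprMn expr2 tt mul1r expr0n/= addr0 /c; nra.
rewrite ca sa mulr0 /rho mulrAC tt mul1r; move: imF; case: (F _) => f1 f2 /= ->.
by [].
Qed.
End SlitHeights.

Lemma limf_esup_at_right_ltP (R : realType) (f : R -> R) (c : R) :
  (limf_esup (fun t => (f t)%:E) 0^'+ < c%:E)%E <->
  exists d K : R, [/\ 0 < d, K < c & forall t, 0 < t < d -> f t <= K].
Proof.
split=> [/ereal_inf_lt[_ [B [d /= d0 dB] <-]] Sc|[d [K [d0 Kc fK]]]].
  have fB t : 0 < t < d -> ((f t)%:E <= ereal_sup ((fun t => (f t)%:E) @` B))%E.
    move=> /andP[t0 td]; apply: ereal_sup_ubound; exists t => //.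
    by apply: dB => //=; rewrite sub0r normrN gtr0_norm.
  move: Sc fB; case: ereal_sup => [K||] Kc fB.
  - by exists d, K; split => // t /fB; rewrite lee_fin.
  - by [].
  - exists d, (c - 1); split => // [|t /fB]; first by rewrite ltrBlDr ltrDl.
    by rewrite leeNy_eq.
apply: (@le_lt_trans _ _ K%:E); last by rewrite lte_fin.
apply: ge_ereal_inf; exists (ereal_sup ((fun t => (f t)%:E) @` `]0, d[%classic)).
  exists (`]0, d[%classic) => //; exists d => //= t /=.
  by rewrite sub0r normrN in_itv/= => td t0; rewrite t0 (le_lt_trans (ler_norm _) td).
by apply: ge_ereal_sup => _ [t /= + <-]; rewrite in_itv/= lee_fin; exact: fK.
Qed.

(** * Slits and gap labels *)

Section SlitsAndGaps.
Context {R : realType} (h : R[i] -> R) (A : R) (dk : probability (measurableTypeR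
  R) R).
Variable F : R[i] -> R[i].
Hypothesis hh : slit_height_function h.
Hypothesis Adk : pair_class A dk.
Hypothesis FE : conformal_extension A dk F.
Hypothesis Oh : region h = F @` unit_disc.
Local Notation U := (log_potential dk).
Local Notation V := (angle_potential dk).
Local Notation u x y := (ln A - U x y).
Let mu1 := pair_class_mass1 Adk.
Let mu0 := pair_class_atomless Adk.
Let intlog := pair_class_integrable_log Adk.

(** Along the vertical segment over [x2], [V] sweeps the angles next to [alpha] on the side [s] of
    [x2] from [x1], while [U] stays below [c < U x1 0]. So [1 - h] exceeds [e^(ln A - c)] at these
    angles but is at most [e^(u x1 0)] at [alpha]. *)
Lemma has_slit_of_level_set alpha x1 x2 : 0 <= alpha <= pi -> -2 <= x1 <= 2 -> x1
  != x2 ->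
  V x1 0 = alpha -> V x2 0 = alpha -> U x2 0 < U x1 0 -> has_slit h alpha.
Proof.
move=> a01 x122 x12 V1 V2 U21.
pose c := (U x2 0 + U x1 0) / 2.
have c1 : U x2 0 < c by rewrite /c; lra.
have c2 : c < U x1 0 by rewrite /c; lra.
have [s s1 s12] : exists2 s : R, s = 1 \/ s = -1 & 0 < s * (x2 - x1).
  have [lt12|lt21|/eqP] := ltgtP x1 x2; last by rewrite (negPf x12).
    by exists 1; [left|rewrite mul1r subr_gt0].
  by exists (-1); [right|rewrite mulN1r opprB subr_gt0].
have ss : s * s = 1 by case: (s1) => ->; ring.
have [d d0 Ud] : exists2 d, 0 < d & U x2 d < c.
  have cU : U x2 y @[y --> 0^'+] --> U x2 0.
    by apply: cvg_at_right_filter; exact: (continuous_log_y mu0 intlog).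
  near (0 : R)^'+ => d; exists d; first by near: d; exact: nbhs_right_gt.
  by near: d; exact: (cvgr_lt _ cU).
pose f y := s * (V x2 y - alpha).
have f0 : f 0 = 0 by rewrite /f V2 subrr mulr0.
(* In [potential_mono] between [(x2, d)] and [(x1, 0)] the height term is negative, so the angle
   term is positive. *)
have fd : 0 < f d.
  have := potential_mono mu0 intlog x2 x1 (ltW d0) (lexx 0).
  rewrite V1 subr0 => H.
  have : 0 < (U x1 0 - U x2 d) * d by rewrite mulr_gt0 ?subr_gt0 ?(lt_trans Ud).
  have fE : f d * (s * (x2 - x1)) = (V x2 d - alpha) * (x2 - x1).
    by rewrite /f [s * _]mulrC -mulrA [s * (s * _)]mulrA ss mul1r.
  by move=> H2; rewrite -(pmulr_lgt0 _ s12) fE; lra.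
have cf : {within `[0, d], continuous f}.
  apply: continuous_subspaceT => y; apply: cvgMr; apply: cvgB; last exact: cvg_cst.
  exact: (continuous_angle_potential_y mu0).
exists s => //; apply/limf_esup_at_right_ltP.
exists (f d), (1 - expR (ln A - c)); split => //.
  have := slit_height_le Adk FE Oh x122 a01 V1.
  have : expR (u x1 0) < expR (ln A - c) by rewrite ltr_expR; lra.
  lra.
move=> t /andP[t0 tf].
have [|y] := IVT (ltW d0) cf (v := t).
  by rewrite f0 (min_idPl (ltW fd)) (max_idPr (ltW fd)) !ltW.
rewrite in_itv/= => /andP[y0 yd] fy.
have {}y0 : 0 < y.
  rewrite lt_neqAle y0 andbT; apply/eqP => y0'.
  by move: t0; rewrite -fy -y0' f0 ltxx.
have -> : alpha + s * t = V x2 y by rewrite -fy /f mulrA ss mul1r subrKC.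
have := slit_above FE Oh x2 y0.
have : expR (ln A - c) < expR (u x2 y).
  rewrite ltr_expR; have := log_potential_le mu0 intlog x2 (ltW y0) yd; lra.
lra.
Unshelve. all: by end_near. Qed.

(** By strict concavity of [U], its value at the midpoint exceeds that at one of the ends; this end
    plays the part of [x2]. *)
Lemma gap_label_has_slit alpha : 0 <= alpha <= pi ->
  gap_label dk (alpha / pi) -> has_slit h alpha.
Proof.
move=> a01 /gap_label_pair[p [q [p2 pq q2 Vp Vq]]].
have pq0 := angle_potential0_eq mu1 mu0 pq (etrans Vp (esym Vq)).
have Um := log_potential_midpoint mu1 intlog pq pq0.
set m := (p + q) / 2 in Um.
have pm : p < m by rewrite /m; lra.
have mq : m < q by rewrite /m; lra.
have Vm : V m 0 = alpha.
  apply/le_anti/andP; split; [rewrite -Vq|rewrite -Vp];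
    by apply: (angle_potential_le mu0 intlog) => //; exact: ltW.
have m22 : -2 <= m <= 2 by apply/andP; split; lra.
have [Upm|Ump] := ltP (U p 0) (U m 0).
  by apply: (has_slit_of_level_set a01 m22 _ Vm Vp Upm); rewrite gt_eqF.
have Uqm : U q 0 < U m 0 by lra.
by apply: (has_slit_of_level_set a01 m22 _ Vm Vq Uqm); rewrite lt_eqF.
Qed.

Lemma angle_potential0_bounds x : -2 <= x <= 2 -> 0 <= V x 0 <= pi.
Proof.
move=> /andP[x1 x2]; rewrite -{1}(angle_potentialN2 mu0) -(angle_potential2 mu1).
by rewrite !(angle_potential_le mu0 intlog).
Qed.

Lemma angle_potential0_surj a : 0 <= a <= pi -> exists2 x, -2 <= x <= 2 & V x 0 = a.
Proof.
move=> a01.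
have cV : {within `[-2, 2], continuous (V ^~ 0)}.
  by apply: continuous_subspaceT => x; exact: (continuous_angle_potential0 mu0).
have le22 : -2 <= 2 :> R by lra.
have [|x] := IVT le22 cV (v := a).
  by rewrite (angle_potentialN2 mu0) (angle_potential2 mu1) (min_idPl (pi_ge0 R))
    (max_idPr (pi_ge0 R)).
by rewrite in_itv/=; exists x.
Qed.

Lemma slit_height_ge x0 a : -2 <= x0 <= 2 -> V x0 0 = a ->
  (forall x, -2 <= x <= 2 -> V x 0 = a -> x = x0) ->
  expR (u x0 0) <= 1 - h (expi a).
Proof.
move=> /andP[x1 x2] Vx0 uniq.
have ge e : 0 < e -> expR (u x0 0 - e) <= 1 - h (expi a).
  move=> e0; have [xl|xl] := eqVneq x0 (-2).
    apply: (slit_height_ge_end Adk FE Oh (t := 1)) => //;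
      [by left|by rewrite mul1r| |];
    by rewrite -Vx0 xl (angle_potentialN2 mu0) ?cos0 ?sin0.
  have [xr|xr] := eqVneq x0 2.
    apply: (slit_height_ge_end Adk FE Oh (t := -1)) => //;
      [by right|by rewrite mulN1r xr| |];
    by rewrite -Vx0 xr (angle_potential2 mu1) ?cospi ?sinpi.
  apply: (slit_height_ge_interior Adk FE Oh) => //.
  by rewrite !lt_def xl x1 eq_sym xr x2.
have h0 : 0 < 1 - h (expi a) by apply: lt_le_trans (ge 1 ltr01); exact: expR_gt0.
rewrite leNgt; apply/negP => lth.
pose e := (u x0 0 - ln (1 - h (expi a))) / 2.
have lne : ln (1 - h (expi a)) < u x0 0.
  by rewrite -[ltRHS]expRK ltr_ln// posrE expR_gt0.
have e0 : 0 < e by rewrite divr_gt0// subr_gt0.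
have := ge e e0; apply/negP; rewrite -ltNge -{1}(lnK (x := 1 - h (expi a))) ?posrE//.
by rewrite ltr_expR /e; lra.
Qed.

(* At [alpha = 0] and [alpha = pi] the symmetry of [h] exchanges the two sides. *)
Lemma has_slit_inward alpha s : 0 <= alpha <= pi -> s = 1 \/ s = -1 ->
  exists r : R, [/\ r = 1 \/ r = -1, alpha = 0 -> r = 1, alpha = pi -> r = -1 &
    forall t, h (expi (alpha + s * t)) = h (expi (alpha + r * t))].
Proof.
move=> a01 s1; have [_ _ hsym] := hh.
have pi0 := pi_gt0 R.
have [a0|a0] := eqVneq alpha 0.
  exists 1; split => //; first by left.
    by rewrite a0 => /esym h0; move: pi0; rewrite h0 ltxx.
  move=> t; rewrite a0 !add0r mul1r.
  by case: s1 => ->; rewrite ?mul1r// mulN1r hsym.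
have [api|api] := eqVneq alpha pi; last first.
  by exists s; split => // /eqP; rewrite ?(negPf a0) ?(negPf api).
exists (-1); split => //; first by right.
  by rewrite api => h0; move: pi0; rewrite h0 ltxx.
move=> t; rewrite api; case: s1 => ->; rewrite ?mul1r ?mulN1r//.
rewrite -[RHS]hsym; congr h; rewrite /expi; congr (_ +i* _).
  by rewrite cosN ![pi + _]addrC !cosDpi cosN.
by rewrite sinN ![pi + _]addrC !sinDpi sinN opprK.
Qed.

(** Without a gap label the real point [x0] is unique, so [1 - h] at [alpha] is at least
    [e^(u x0 0)]. A slit keeps [1 - h] at or above some [1 - K > e^(u x0 0)] at nearby angles on one
    side, but [log_potential_approach] gives [x] on that side with [e^(u x 0) < 1 - K]. *)
Lemma has_slit_gap_label alpha : 0 <= alpha <= pi ->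
  has_slit h alpha -> gap_label dk (alpha / pi).
Proof.
move=> a01 [s0 s01 /limf_esup_at_right_ltP[d [K [d0 Kh hK]]]].
apply: contrapT => nogap.
have [x0 x022 Vx0] := angle_potential0_surj a01.
have uniq x : -2 <= x <= 2 -> V x 0 = alpha -> x = x0.
  move=> /andP[x1 x2] Vx; move: x022 => /andP[x01 x02].
  have [ltx|ltx|//] := ltgtP x x0; exfalso; apply: nogap.
    exact: (pair_gap_label mu1 mu0 intlog x1 ltx x02).
  exact: (pair_gap_label mu1 mu0 intlog x01 ltx x2).
have hge := slit_height_ge x022 Vx0 uniq.
have [s [s1 sa0 sapi hs]] := has_slit_inward a01 s01.
have {}hK t : 0 < t < d -> h (expi (alpha + s * t)) <= K by rewrite -hs; exact: hK.
(* Points on the side [s] stay in [[-2, 2]]: at an end of the interval [s] points inwards, and 4 is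
   the length of the interval. *)
have [d2 d20 d2H] : exists2 d2, 0 < d2 & forall x,
  0 < s * (x - x0) < d2 -> -2 <= x <= 2.
  move: x022 => /andP[x01 x02].
  have [xl|xl] := eqVneq x0 (-2).
    exists 4 => // x; rewrite sa0; last by rewrite -Vx0 xl (angle_potentialN2 mu0).
    by rewrite xl mul1r opprK => /andP[? ?]; apply/andP; split; lra.
  have [xr|xr] := eqVneq x0 2.
    exists 4 => // x; rewrite sapi; last by rewrite -Vx0 xr (angle_potential2 mu1).
    by rewrite xr mulN1r opprB => /andP[? ?]; apply/andP; split; lra.
  have xl' : -2 < x0 by rewrite lt_def xl x01.
  have xr' : x0 < 2 by rewrite lt_def eq_sym xr x02.
  exists (Num.min (x0 + 2) (2 - x0)); first by rewrite lt_min; apply/andP; split; lra.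
  move=> x; rewrite lt_min => /and3P[].
  by case: (s1) => -> ? ? ?; apply/andP; split; lra.
have /cvgrPdist_lt/(_ _ d0)[d1 /= d10 d1H] := @continuous_angle_potential0 _ _ mu0 x0.
pose e := (ln (1 - K) - u x0 0) / 2.
have K1 : expR (u x0 0) < 1 - K by lra.
have K0 : 0 < 1 - K by rewrite (lt_trans _ K1)// expR_gt0.
have lnK1 : u x0 0 < ln (1 - K) by rewrite -[ltLHS]expRK ltr_ln// posrE expR_gt0.
have e0 : 0 < e by rewrite divr_gt0// subr_gt0.
have d120 : 0 < Num.min d1 d2 by rewrite lt_min d10 d20.
have [x /andP[x1 +] Ux] := log_potential_approach mu1 mu0 intlog x0 s1 e0 d120.
rewrite lt_min => /andP[xd1 xd2].
have x22 : -2 <= x <= 2 by apply: d2H; rewrite x1 xd2.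
have nt : `|s| = 1 by case: (s1) => ->; rewrite ?normrN normr1.
have ss : s * s = 1 by case: (s1) => ->; ring.
pose t := s * (V x 0 - alpha).
have Vd : `|alpha - V x 0| < d.
  rewrite -Vx0; apply: d1H; rewrite /ball_/= distrC.
  by rewrite -[ltLHS]mul1r -nt -normrM gtr0_norm.
(* Monotonicity of [V] at height 0 gives the sign, uniqueness of [x0] excludes [t = 0]. *)
have t0 : 0 < t.
  rewrite lt_neqAle; apply/andP; split.
    apply/eqP => /esym/eqP; rewrite mulf_eq0 => /orP[/eqP s00|].
      by move: nt; rewrite s00 normr0 => /esym/eqP; rewrite oner_eq0.
    by rewrite subr_eq0 => /eqP /(uniq _ x22) xx0; move: x1;
      rewrite xx0 subrr mulr0 ltxx.
  rewrite /t -Vx0; case: (s1) x1 => ->;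
    rewrite ?mul1r ?mulN1r ?opprB !subr_gt0 subr_ge0 => /ltW;
  exact: (angle_potential_le mu0 intlog).
have td : t < d.
  apply: le_lt_trans Vd; rewrite (le_trans (ler_norm _))// /t normrM nt mul1r distrC.
  by [].
have := hK t; rewrite t0 td => /(_ isT).
have -> : alpha + s * t = V x 0 by rewrite /t mulrA ss mul1r subrKC.
have hle := slit_height_le Adk FE Oh x22 (angle_potential0_bounds x22) erefl.
have ltK : expR (u x 0) < 1 - K.
  have aux (l k v w : R) : v - (k - (l - v)) / 2 <= w -> l - v < k -> l - w < k by
    lra.
  by rewrite -[ltRHS](lnK (x := 1 - K)) ?posrE// ltr_expR; exact: aux Ux lnK1.
by have := le_lt_trans hle ltK; rewrite ltrD2l ltrN2 ltNge => /negP.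
Qed.

End SlitsAndGaps.

Theorem theorem6p1 (R : realType) (Omega : set R[i]) (h : R[i] -> R)
    (A : R) (dk : probability (measurableTypeR R) R) (alpha : R) :
  slit_height_function h -> Omega = region h ->
  pair_class A dk -> associated Omega A dk ->
  0 <= alpha <= pi ->
  has_slit h alpha <-> gap_label dk (alpha / pi).
Proof.
move=> hh -> Adk [F FE Oh] a01; split.
- exact: (has_slit_gap_label hh Adk FE Oh a01).
- exact: (gap_label_has_slit Adk FE Oh a01).
Qed.
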